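(* Let $a=(a_1,\dots,a_n)$ be a tuple of distinct complex numbers, and let $\widetilde{\mathscr{V}_a}=\mathscr{V}_a\oplus\bigoplus_{i=1}^n\mathbb{C}c_i$ as a vector space, with bracket $$[f\partial+u,\,g\partial+v]=[f\partial,g\partial]+\sum_{i=1}^n\phi_i(f\partial,g\partial)\,c_i,\qquad f,g\in R_a,\ u,v\in\bigoplus_{i=1}^n\mathbb{C}c_i.$$ Then $\widetilde{\mathscr{V}_a}$ (with the projection onto $\mathscr{V}_a$) is the universal central extension of the Lie algebra $\mathscr{V}_a$.
   Context: $\mathbb{N}=\{1,2,\dots\}$, $\mathbb{Z}_+=\{0,1,2,\dots\}$, $n\in\mathbb{N}$. $R_a$ is the subalgebra of $\mathbb{C}(t)$ generated by $t,(t-a_1)^{-1},\dots,(t-a_n)^{-1}$, and $\mathscr{V}_a=\operatorname{Der}(R_a)=R_a\partial$ with $\partial=d/dt$, a Lie algebra with bracket $[f\partial,g\partial]=(f\partial(g)-g\partial(f))\partial$. It has the basis $\{t^k\partial,(t-a_1)^{-l}\partial,\dots,(t-a_n)^{-l}\partial\mid k\in\mathbb{Z}_+,l\in\mathbb{N}\}$. For $1\le i\le n$, $\phi_i:\mathscr{V}_a\times\mathscr{V}_a\to\mathbb{C}$ is the skew-symmetric bilinear map given on basis elements by $$\phi_i(t^{k+1}\partial,(t-a_i)^{-l+1}\partial)=\begin{cases}\binom{k+1}{l+1}a_i^{k-l}(l^3-l),\ k,l\in\mathbb{Z}_+,&\text{if }a_i\ne0,\\ \delta_{k,l}(l^3-l),\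 k,l\in\mathbb{Z},&\text{if }a_i=0,\end{cases}$$ $$\phi_i((t-a_i)^{-k}\partial,(t-a_j)^{-l}\partial)=\frac{(k+l+1)!}{(k-1)!\,(l-1)!\,(a_j-a_i)^{k+1}(a_i-a_j)^{l+1}},\quad k,l\in\mathbb{N},\ j\ne i,$$ and $\phi_i=0$ on all other pairs of basis elements (up to skew-symmetry). *)

(* Defs.v *)
From HB Require Import structures.
From mathcomp Require Import all_boot all_order all_algebra.
From mathcomp Require Import ring.
From mathcomp Require Import boolp classical_sets functions.

Set Implicit Arguments.
Unset Strict Implicit.
Unset Printing Implicit Defensive.

Import GRing.Theory.
Local Open Scope ring_scope.
Local Open Scope quotient_scope.

Section LieAlgebras.
Context {F : fieldType}.
Implicit Types L E : lmodType F.

Definition lie_bracket L (br : L -> L -> L) : Prop :=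
  [/\ forall x, linear (br x),
      forall y, linear (br^~ y),
      forall x, br x x = 0 &
      forall x y z, br x (br y z) + br y (br z x) + br z (br x y) = 0].

Definition lie_hom L1 L2 (br1 : L1 -> L1 -> L1) (br2 : L2 -> L2 -> L2)
    (h : L1 -> L2) : Prop :=
  linear h /\ {morph h : x y / br1 x y >-> br2 x y}.

Definition central_extension E L (brE : E -> E -> E) (brL : L -> L -> L)
    (p : E -> L) : Prop :=
  [/\ lie_bracket brE, lie_bracket brL, lie_hom brE brL p,
      forall y, exists x, p x = y &
      forall z, p z = 0 -> forall x, brE z x = 0].

Definition universal_central_extension E L (brE : E -> E -> E)
    (brL : L -> L -> L) (p : E -> L) : Prop :=
  central_extension brE brL p /\
  forall (E' : lmodType F) (brE' : E' -> E' -> E') (p' : E' -> L),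
    central_extension brE' brL p' ->
    exists! h : E -> E', lie_hom brE brE' h /\ p' \o h = p.

End LieAlgebras.

Section FractionDerivation.
Variables (A : idomainType) (d : A -> A).
Hypothesis dD : {morph d : x y / x + y}.
Hypothesis dM : forall x y, d (x * y) = d x * y + x * d y.
Local Notation K := {fraction A}.
Local Notation tofrac := (@FracField.tofrac A).

(* The quotient rule, computed on a representative; [frac_derivE] states
   independence of the choice. *)
Definition frac_deriv (x : K) : K :=
  let p := (frac (repr x)).1 in
  let q := (frac (repr x)).2 in
  tofrac (d p * q - p * d q) / tofrac (q ^+ 2).

Lemma frac_reprE (x : K) :
  x = tofrac (frac (repr x)).1 / tofrac (frac (repr x)).2.
Proof.
set r := repr x; have d0 : (frac r).2 != 0 := denom_ratioP r.
have dF : tofrac (frac r).2 != 0 by rewrite tofrac_eq0.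
apply: (canRL (mulfK dF)).
rewrite -[x in LHS](reprK x) -/r; apply/eqP.
rewrite [_ * _]piE /= [tofrac (frac r).1]piE eqmodE /= FracField.equivfE.
rewrite /FracField.mulf !numden_Ratio ?oner_eq0 ?mulr1 ?oner_neq0 //.
by rewrite mulrC.
Qed.

Lemma frac_ind (P : K -> Prop) :
  (forall p q : A, q != 0 -> P (tofrac p / tofrac q)) -> forall x, P x.
Proof. by move=> H x; rewrite [x]frac_reprE; apply/H/denom_ratioP. Qed.

Lemma frac_derivE (p q : A) : q != 0 ->
  frac_deriv (tofrac p / tofrac q) =
  tofrac (d p * q - p * d q) / tofrac (q ^+ 2).
Proof.
move=> q0; rewrite /frac_deriv.
have := frac_reprE (tofrac p / tofrac q).
have := denom_ratioP (repr (tofrac p / tofrac q : K)).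
move: (frac _) => [m e] /= e0 /eqP.
have tf0 (u : A) : u != 0 -> tofrac u != 0 by rewrite tofrac_eq0.
rewrite eqr_div ?tf0 // -!rmorphM /= tofrac_eq => /eqP eq_pe.
have eq_d := congr1 d eq_pe; rewrite !dM in eq_d.
apply/eqP; rewrite eqr_div ?tf0 ?expf_neq0 // -!rmorphM /= tofrac_eq.
apply/eqP.
have -> : (d m * e - m * d e) * q ^+ 2 =
  e * q * (d m * q + m * d q) - (m * q) * (e * d q + q * d e) by ring.
by rewrite -eq_d -eq_pe; ring.
Qed.

Let quotient_ruleM (k : fieldType) (f : {rmorphism A -> k}) p q r s :
  f q != 0 -> f s != 0 ->
  f (d (p * r) * (q * s) - p * r * d (q * s)) / f ((q * s) ^+ 2) =
  f (d p * q - p * d q) / f (q ^+ 2) * (f r / f s) +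
  f p / f q * (f (d r * s - r * d s) / f (s ^+ 2)).
Proof.
move=> q0 s0; rewrite !dM !(rmorphXn, rmorphM, rmorphB, rmorphD) /=.
by field; rewrite q0 s0.
Qed.

Lemma frac_derivM x y :
  frac_deriv (x * y) = frac_deriv x * y + x * frac_deriv y.
Proof.
elim/frac_ind: x => p q q0; elim/frac_ind: y => r s s0.
have ->: tofrac p / tofrac q * (tofrac r / tofrac s) =
  tofrac (p * r) / tofrac (q * s) by rewrite mulf_div -!rmorphM.
rewrite !frac_derivE ?mulf_neq0 //.
by apply: quotient_ruleM; rewrite /= tofrac_eq0.
Qed.

Let quotient_ruleD (k : fieldType) (f : {rmorphism A -> k}) p q r s :
  f q != 0 -> f s != 0 ->
  f (d (p * s + r * q) * (q * s) - (p * s + r * q) * d (q * s))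
    / f ((q * s) ^+ 2) =
  f (d p * q - p * d q) / f (q ^+ 2) + f (d r * s - r * d s) / f (s ^+ 2).
Proof.
move=> q0 s0; rewrite dD !dM !(rmorphXn, rmorphM, rmorphB, rmorphD) /=.
by field; rewrite q0 s0.
Qed.

Lemma frac_derivD : {morph frac_deriv : x y / x + y}.
Proof.
elim/frac_ind => p q q0; elim/frac_ind => r s s0.
have qF : tofrac q != 0 by rewrite tofrac_eq0.
have sF : tofrac s != 0 by rewrite tofrac_eq0.
have ->: tofrac p / tofrac q + tofrac r / tofrac s =
  tofrac (p * s + r * q) / tofrac (q * s).
  by rewrite addf_div // -!rmorphM -rmorphD.
rewrite !frac_derivE ?mulf_neq0 //.
exact: quotient_ruleD.
Qed.

Lemma frac_deriv_tofrac p : frac_deriv (tofrac p) = tofrac (d p).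
Proof.
have d1 : d 1 = 0.
  by apply: (addrI (d 1)); rewrite addr0 -{3}[1]mulr1 dM mulr1 mul1r.
have -> : tofrac p = tofrac p / tofrac 1 by rewrite rmorph1 divr1.
by rewrite frac_derivE ?oner_neq0 // d1 mulr0 subr0 mulr1 expr1n rmorph1 divr1.
Qed.

End FractionDerivation.

Definition ratfun (F : fieldType) : Type := {fraction {poly F}}.

Section RationalFunctions.
Variable F : fieldType.
Local Notation K := (ratfun F).
Local Notation tofrac := (@FracField.tofrac {poly F}).

HB.instance Definition _ := GRing.Field.on K.

Definition ratfun_scale (c : F) (x : K) : K := tofrac c%:P * x.

Fact ratfun_scaleA c d x :
  ratfun_scale c (ratfun_scale d x) = ratfun_scale (c * d) x.
Proof. by rewrite /ratfun_scale polyCM rmorphM mulrA. Qed.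
Fact ratfun_scale1 : left_id 1 ratfun_scale.
Proof. by move=> x; rewrite /ratfun_scale rmorph1 mul1r. Qed.
Fact ratfun_scaleDr : right_distributive ratfun_scale +%R.
Proof. by move=> c x y; rewrite /ratfun_scale mulrDr. Qed.
Fact ratfun_scaleDl x : {morph ratfun_scale^~ x : c d / c + d}.
Proof. by move=> c d; rewrite /ratfun_scale polyCD rmorphD mulrDl. Qed.
HB.instance Definition _ := GRing.Zmodule_isLmodule.Build F K
  ratfun_scaleA ratfun_scale1 ratfun_scaleDr ratfun_scaleDl.

Fact ratfun_scaleAl (c : F) (x y : K) : c *: (x * y) = (c *: x) * y.
Proof. exact: mulrA. Qed.
HB.instance Definition _ := GRing.Lmodule_isLalgebra.Build F K ratfun_scaleAl.

Fact ratfun_scaleAr (c : F) (x y : K) : c *: (x * y) = x * (c *: y).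
Proof. exact: mulrCA. Qed.
HB.instance Definition _ := GRing.Lalgebra_isAlgebra.Build F K ratfun_scaleAr.

Definition ratfun_t : K := tofrac 'X.

End RationalFunctions.

HB.lock Definition ratfun_deriv (F : fieldType) (x : ratfun F) : ratfun F :=
  frac_deriv (@deriv F) x.

Section RationalDerivation.
Variable F : fieldType.
Local Notation K := (ratfun F).
Local Notation tofrac := (@FracField.tofrac {poly F}).

Lemma ratfun_derivM (x y : K) :
  ratfun_deriv (x * y) = ratfun_deriv x * y + x * ratfun_deriv y.
Proof. rewrite ratfun_deriv.unlock; exact: (frac_derivM (@derivM F)). Qed.

Lemma ratfun_deriv_is_linear : linear (@ratfun_deriv F).
Proof.
move=> c x y; rewrite ratfun_deriv.unlock.
rewrite [LHS](frac_derivD (@derivD F) (@derivM F)); congr (_ + _).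
rewrite [LHS](frac_derivM (@derivM F)) [X in X * _](frac_deriv_tofrac (@derivM F)).
by rewrite derivC rmorph0 mul0r add0r.
Qed.
HB.instance Definition _ :=
  GRing.isLinear.Build F K K *:%R (@ratfun_deriv F) ratfun_deriv_is_linear.

Lemma ratfun_deriv1 : ratfun_deriv (1 : K) = 0.
Proof.
apply: (addrI (ratfun_deriv 1)); rewrite addr0.
by rewrite -{3}[1 : K]mulr1 ratfun_derivM mulr1 mul1r.
Qed.

Lemma ratfun_deriv_t : ratfun_deriv (ratfun_t F) = 1.
Proof.
rewrite ratfun_deriv.unlock [LHS](frac_deriv_tofrac (@derivM F)).
by rewrite derivX rmorph1.
Qed.

Lemma ratfun_derivV (x : K) :
  x != 0 -> ratfun_deriv x^-1 = - (ratfun_deriv x * x ^- 2).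
Proof.
move=> x0; have /eqP := ratfun_deriv1; rewrite -[X in ratfun_deriv X](mulfV x0).
rewrite ratfun_derivM addrC addr_eq0 => /eqP e.
by rewrite -[LHS](mulKf x0) e mulrN mulrCA -invfM.
Qed.

End RationalDerivation.

Section Ra.
Context {F : fieldType} {n : nat}.
Variable a : 'I_n -> F.
Local Notation K := (ratfun F).
Local Notation t := (ratfun_t F).

Definition Ra_pred : {pred K} := fun x =>
  `[< forall S : {pred K}, GRing.subalg_closed S -> t \in S ->
        (forall i, (t - (a i)%:A)^-1 \in S) -> x \in S >].

Lemma Ra_predP x : reflect
  (forall S : {pred K}, GRing.subalg_closed S -> t \in S ->
    (forall i, (t - (a i)%:A)^-1 \in S) -> x \in S) (x \in Ra_pred).
Proof. exact: asboolP. Qed.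

Fact Ra_subalg_closed : GRing.subalg_closed Ra_pred.
Proof.
split=> [|c x y /Ra_predP xR /Ra_predP yR|x y /Ra_predP xR /Ra_predP yR];
  apply/Ra_predP => S SA St Sa; have [S1 SD SM] := SA.
- exact: S1.
- by apply: SD; [apply: xR | apply: yR].
- by apply: SM; [apply: xR | apply: yR].
Qed.
HB.instance Definition _ :=
  GRing.isSubalgClosed.Build F K Ra_pred Ra_subalg_closed.

Record Ra := MkRa { Ra_val : K; Ra_valP : Ra_val \in Ra_pred }.
HB.instance Definition _ := [isSub for Ra_val].
HB.instance Definition _ := [Choice of Ra by <:].
HB.instance Definition _ := [SubChoice_isSubComNzRing of Ra by <:].
HB.instance Definition _ := [SubZmodule_isSubLmodule of Ra by <:].
HB.instance Definition _ := [SubNzRing_SubLmodule_isSubLalgebra of Ra by <:].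
HB.instance Definition _ := [SubLalgebra_isSubAlgebra of Ra by <:].

Fact Ra_t_subproof : t \in Ra_pred.
Proof. by apply/Ra_predP => S _ St _. Qed.
Definition Ra_t : Ra := MkRa Ra_t_subproof.

Fact Ra_pole_subproof i : (t - (a i)%:A)^-1 \in Ra_pred.
Proof. by apply/Ra_predP => S _ _; apply. Qed.

Lemma Ra_ind (P : Ra -> Prop) : P 1 ->
  (forall c f g, P f -> P g -> P (c *: f + g)) ->
  (forall f g, P f -> P g -> P (f * g)) ->
  P Ra_t -> (forall f i, Ra_val f = (t - (a i)%:A)^-1 -> P f) ->
  forall f, P f.
Proof.
move=> P1 PD PM Pt Pp f.
pose S : {pred K} := fun x => `[< exists2 g : Ra, Ra_val g = x & P g >].
suff /asboolP[g /val_inj <-] : Ra_val f \in S by [].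
move/Ra_predP: (Ra_valP f); apply.
- split; first by apply/asboolP; exists 1.
  + move=> c _ _ /asboolP[g <- Pg] /asboolP[h <- Ph].
    by apply/asboolP; exists (c *: g + h) => //; exact: PD.
  + move=> _ _ /asboolP[g <- Pg] /asboolP[h <- Ph].
    by apply/asboolP; exists (g * h) => //; exact: PM.
- by apply/asboolP; exists Ra_t.
- by move=> i; apply/asboolP; exists (MkRa (Ra_pole_subproof i)) => //; exact: Pp.
Qed.

Fact ratfun_deriv_Ra (f : Ra) : ratfun_deriv (Ra_val f) \in Ra_pred.
Proof.
elim/Ra_ind: f => [|c f g fR gR|f g fR gR||f i ->].
- by rewrite [X in ratfun_deriv X]/= ratfun_deriv1 rpred0.
- rewrite [X in ratfun_deriv X]/= linearP; apply: rpredD => //.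
  exact: rpredZ.
- rewrite [X in ratfun_deriv X]/= ratfun_derivM; apply: rpredD.
    exact: rpredM fR (Ra_valP g).
  exact: rpredM (Ra_valP f) gR.
- by rewrite [X in ratfun_deriv X]/= ratfun_deriv_t rpred1.
have [y0|y0] := eqVneq (t - (a i)%:A) 0.
  by rewrite y0 invr0 linear0 rpred0.
rewrite ratfun_derivV // linearB linearZ /= ratfun_deriv1 scaler0 subr0.
rewrite ratfun_deriv_t mul1r -exprVn rpredN; apply: rpredX.
exact: Ra_pole_subproof.
Qed.

Definition Ra_deriv (f : Ra) : Ra := MkRa (ratfun_deriv_Ra f).

Lemma Ra_derivM f g : Ra_deriv (f * g) = Ra_deriv f * g + f * Ra_deriv g.
Proof. by apply: val_inj; rewrite /= ratfun_derivM. Qed.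

Lemma Ra_deriv_is_linear : linear Ra_deriv.
Proof. by move=> c f g; apply: val_inj; rewrite /= linearP. Qed.
HB.instance Definition _ :=
  GRing.isLinear.Build F Ra Ra *:%R Ra_deriv Ra_deriv_is_linear.

Lemma Ra_deriv_t : Ra_deriv Ra_t = 1.
Proof. by apply: val_inj; rewrite /= ratfun_deriv_t. Qed.

Definition derivation (D : Ra -> Ra) : Prop :=
  linear D /\ forall f g, D (f * g) = D f * g + f * D g.

Definition derivation_pred : {pred Ra -> Ra} := fun D => `[< derivation D >].

Fact derivation_submod_closed : GRing.submod_closed derivation_pred.
Proof.
split=> [|c D E /asboolP[Dl DM] /asboolP[El EM]]; apply/asboolP; split.
- by move=> c f g; rewrite scaler0 addr0.
- by move=> f g; rewrite mul0r mulr0 addr0.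
- move=> k f g; rewrite !fctE Dl El !scalerDr !scalerA -!addrA mulrC.
  by congr (_ + _); rewrite addrCA.
- move=> f g; rewrite !fctE DM EM !mulrDl !mulrDr scalerDr -scalerAl -scalerAr.
  by rewrite addrACA.
Qed.
HB.instance Definition _ :=
  GRing.isSubmodClosed.Build F (Ra -> Ra) derivation_pred
    derivation_submod_closed.

Record Der := MkDer { Der_fun :> Ra -> Ra; DerP : Der_fun \in derivation_pred }.
HB.instance Definition _ := [isSub for Der_fun].
HB.instance Definition _ := [Choice of Der by <:].
HB.instance Definition _ := [SubChoice_isSubZmodule of Der by <:].
HB.instance Definition _ := [SubZmodule_isSubLmodule of Der by <:].

Lemma Der_linear (D : Der) : linear D.
Proof. by have /asboolP[] := DerP D. Qed.

Lemma DerM (D : Der) f g : D (f * g) = D f * g + f * D g.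
Proof. by have /asboolP[_] := DerP D; apply. Qed.

HB.instance Definition _ (D : Der) :=
  GRing.isLinear.Build F Ra Ra *:%R D (Der_linear D).

Fact vf_subproof (f : Ra) : (fun g => f * Ra_deriv g) \in derivation_pred.
Proof.
apply/asboolP; split=> [c g h|g h]; first by rewrite linearP mulrDr -scalerAr.
by rewrite Ra_derivM mulrDr mulrA mulrCA.
Qed.

(* [vf f] is f d/dt; by [Der_vf] every derivation of R_a has this form. *)
Definition vf (f : Ra) : Der := MkDer (vf_subproof f).

Fact der_bracket_subproof (D E : Der) :
  (fun f => D (E f) - E (D f)) \in derivation_pred.
Proof.
apply/asboolP; split=> [c f g|f g].
  by rewrite !Der_linear scalerBr opprD addrACA.
rewrite (DerM E) (DerM D f g) !raddfD /= !DerM.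
move: (D (E f)) (E (D f)) (D (E g)) (E (D g)) => u v x y.
rewrite mulrBl mulrBr; ring.
Qed.

Definition der_bracket (D E : Der) : Der := MkDer (der_bracket_subproof D E).

Lemma Der_vf (D : Der) : D = vf (D Ra_t).
Proof.
have D1 (E : Der) : E 1 = 0.
  by apply: (addrI (E 1)); rewrite addr0 -{3}[1 : Ra]mulr1 DerM mulr1 mul1r.
apply: val_inj; apply/funext => f; set E := vf _; change (D f = E f).
elim/Ra_ind: f => [|c f g Df Dg|f g Df Dg||f i fE]; first by rewrite !D1.
- by rewrite !Der_linear Df Dg.
- by rewrite !DerM Df Dg.
- by rewrite /E /= Ra_deriv_t mulr1.
pose y : Ra := - a i *: 1 + Ra_t.
have yE : Ra_val y = t - (a i)%:A.
  by rewrite -scaleNr addrC; exact: (linearP (val : Ra -> K)).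
have Dy : D y = E y.
  by rewrite !Der_linear !D1; congr (_ + _); rewrite /E /= Ra_deriv_t mulr1.
rewrite -yE in fE; have [y0|y0] := eqVneq (Ra_val y) 0.
  have -> : f = 0 by apply: val_inj; rewrite [LHS]fE y0 invr0.
  by rewrite !raddf0.
have fy : f * y = 1 by apply: val_inj; rewrite [LHS]/= fE mulVf.
have e (D' : Der) : D' f = - (f * (f * D' y)).
  have /eqP := D1 D'; rewrite -[X in D' X]fy DerM addr_eq0 => /eqP h.
  by rewrite -[LHS]mulr1 -fy mulrCA h mulrN.
by rewrite !e Dy.
Qed.

Lemma der_bracket_vf f g :
  der_bracket (vf f) (vf g) = vf (f * Ra_deriv g - g * Ra_deriv f).
Proof. by rewrite [LHS]Der_vf; congr vf; rewrite /= !Ra_deriv_t !mulr1. Qed.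

Definition Ra_basis (f : Ra) : Prop :=
  (exists k : nat, Ra_val f = t ^+ k) \/
  (exists j (l : nat), (0 < l)%N /\ Ra_val f = (t - (a j)%:A) ^- l).

(* [phi_value i f g c]: the prescribed value of phi_i (f d/dt, g d/dt) is c.
   Powers with an integer exponent are taken in C(t). *)
Inductive phi_value (i : 'I_n) : Ra -> Ra -> F -> Prop :=
| Phi_neq0 f g (k l : nat) of a i != 0 &
    Ra_val f = t ^ (k%:Z + 1) & Ra_val g = (t - (a i)%:A) ^ (- l%:Z + 1) :
    phi_value i f g
      ('C(k + 1, l + 1)%:R * a i ^ (k%:Z - l%:Z) * (l%:R ^+ 3 - l%:R))
| Phi_eq0 f g (k l : int) of a i = 0 &
    Ra_val f = t ^ (k + 1) & Ra_val g = (t - (a i)%:A) ^ (- l + 1) :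
    phi_value i f g ((k == l)%:R * (l%:~R ^+ 3 - l%:~R))
| Phi_poles f g j (k l : nat) of j != i & (0 < k)%N & (0 < l)%N &
    Ra_val f = (t - (a i)%:A) ^- k & Ra_val g = (t - (a j)%:A) ^- l :
    phi_value i f g
      (((k + l + 1)`!)%:R /
       (((k - 1)`!)%:R * ((l - 1)`!)%:R *
        (a j - a i) ^+ (k + 1) * (a i - a j) ^+ (l + 1))).

Definition phi_spec (i : 'I_n) (B : Der -> Der -> F) : Prop :=
  [/\ (forall D, scalar (B D)) /\ (forall E, scalar (B^~ E)),
      forall D E, B D E = - B E D,
      forall f g c, phi_value i f g c -> B (vf f) (vf g) = c &
      forall f g, Ra_basis f -> Ra_basis g ->
        (forall c, ~ phi_value i f g c) -> (forall c, ~ phi_value i g f c) ->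
        B (vf f) (vf g) = 0].

(* When the [a i] are distinct, [phi_spec i] has exactly one solution, because
   the [vf f] with [Ra_basis f] form a basis of [Der]; [phi i] is that
   solution. *)
Definition phi (i : 'I_n) : Der -> Der -> F :=
  xget (fun _ _ => 0) [set B | phi_spec i B]%classic.

(* [delta_mx 0 i] is the central element c_i. *)
Definition ext_bracket (x y : Der * 'rV[F]_n) : Der * 'rV[F]_n :=
  (der_bracket x.1 y.1, \sum_(i < n) phi i x.1 y.1 *: delta_mx 0 i).

End Ra.

Arguments Ra {F n} a.
Arguments Der {F n} a.
Arguments der_bracket {F n} a D E.
Arguments phi {F n} a i _ _.
Arguments ext_bracket {F n} a x y.

(* Main.v *)
From HB Require Import structures.
Require Import Defs.
From mathcomp Require Import all_boot all_order all_algebra.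
From mathcomp Require Import ring zify.
From mathcomp Require Import boolp classical_sets.
From mathcomp Require Import complex reals.

(** The form phi_i is (f d/dt, g d/dt) |-> Res_(a_i) (f^(3) g), and it is a
    2-cocycle because the cyclic sum of f^(3) (g h' - h g') is the derivative
    of a Wronskian determinant.

    In a central extension E of Der(R_a) the bracket descends to a bilinear map
    B on R_a. The relations [d/dt, g d/dt] = g' d/dt and
    [(t - a_i) d/dt, (t - a_i)^-1 d/dt] = -2 (t - a_i)^-1 d/dt dictate a linear
    section s of E. The cocycle eta(f, g) = B(f, g) - s([f, g]) then vanishes
    on (1, f) and on (t, (t - a_i)^-1), and subtracting a combination of the
    phi_i makes it vanish on (t^3, (t - a_i)^-1). Such a cocycle is zero.
    First, eta(t^k, g') = - k eta(t^(k-1), g), and the cocycle identity with t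
    gives (3 - k) eta(t^k, (t - a_i)^-1) = 0, so C[t] lies in the radical of
    eta and eta is invariant under C[t] d/dt. For i <> j a
    polynomial congruent to t - a_j at a_j and to 0 at a_i, both to high order,
    then shows that eta((t - a_i)^-k, (t - a_j)^-l) = 0; for i = j the
    polynomial t - a_i does. *)

Set Implicit Arguments.
Unset Strict Implicit.
Unset Printing Implicit Defensive.

Import GRing.Theory Num.Theory.
Local Open Scope ring_scope.

(** * Evaluation and residues of rational functions *)

Section Evaluation.
Variables (F : fieldType) (b : F).
Local Notation K := (ratfun F).
Local Notation tofrac := (@FracField.tofrac {poly F}).
Implicit Types (x y g h : K) (p q : {poly F}).

Definition pfrac p : K := tofrac p.

Fact pfrac_is_zmod_morphism : zmod_morphism pfrac.
Proof. exact: (rmorphB tofrac). Qed.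
HB.instance Definition _ :=
  GRing.isZmodMorphism.Build {poly F} K pfrac pfrac_is_zmod_morphism.

Fact pfrac_is_monoid_morphism : monoid_morphism pfrac.
Proof. by split; [exact: (rmorph1 tofrac) | exact: (rmorphM tofrac)]. Qed.
HB.instance Definition _ :=
  GRing.isMonoidMorphism.Build {poly F} K pfrac pfrac_is_monoid_morphism.

(** A relation, because only a fraction whose denominator does not vanish at [b] yields a value;
    [evaluates_to_fun] gives independence of the fraction. At a pole no value exists and [eval_at]
    takes the default 0. *)
Definition evaluates_to x (c : F) : Prop :=
  exists p q, [/\ q.[b] != 0, x = pfrac p / pfrac q & c = p.[b] / q.[b]].

Definition regular x : Prop := exists c, evaluates_to x c.

Definition eval_at x : F := xget 0 (evaluates_to x).

Lemma pfrac_eq0 p : (pfrac p == 0) = (p == 0).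
Proof. exact: tofrac_eq0. Qed.

Lemma pfrac_inj : injective pfrac.
Proof. by move=> p q /eqP; rewrite tofrac_eq => /eqP. Qed.

Lemma horner_neq0 q : q.[b] != 0 -> q != 0.
Proof. by apply: contraNneq => ->; rewrite horner0. Qed.

Lemma evaluates_to_fun x c d : evaluates_to x c -> evaluates_to x d -> c = d.
Proof.
move=> [p [q [qb -> ->]]] [r [s [sb /eqP + ->]]].
rewrite eqr_div ?pfrac_eq0 ?horner_neq0 // -!rmorphM /= (inj_eq pfrac_inj) =>
  /eqP e.
by apply/eqP; rewrite eqr_div // -!hornerM e.
Qed.

Lemma eval_atE x c : evaluates_to x c -> eval_at x = c.
Proof.
by move=> xc; apply: (evaluates_to_fun _ xc); exact: (xgetI 0 xc).
Qed.

Lemma eval_atP x : regular x -> evaluates_to x (eval_at x).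
Proof. by move=> [c xc]; rewrite (eval_atE xc). Qed.

Lemma evaluates_pfrac p : evaluates_to (pfrac p) p.[b].
Proof.
exists p, 1; split; last by rewrite hornerC divr1.
- by rewrite hornerC oner_neq0.
- by rewrite rmorph1 divr1.
Qed.

Lemma evaluates_to1 : evaluates_to 1 1.
Proof. by have := evaluates_pfrac 1; rewrite rmorph1 hornerC. Qed.

Lemma evaluates_toD x y c d :
  evaluates_to x c -> evaluates_to y d -> evaluates_to (x + y) (c + d).
Proof.
move=> [p [q [qb -> ->]]] [r [s [sb -> ->]]].
exists (p * s + r * q), (q * s); split.
- by rewrite hornerM mulf_neq0.
- by rewrite addf_div ?pfrac_eq0 ?horner_neq0 // -!rmorphM -rmorphD.
- by rewrite addf_div // !hornerE.
Qed.

Lemma evaluates_toM x y c d :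
  evaluates_to x c -> evaluates_to y d -> evaluates_to (x * y) (c * d).
Proof.
move=> [p [q [qb -> ->]]] [r [s [sb -> ->]]].
exists (p * r), (q * s); split.
- by rewrite hornerM mulf_neq0.
- by rewrite mulf_div // -!rmorphM.
- by rewrite mulf_div // !hornerE.
Qed.

Lemma evaluates_toX x c m : evaluates_to x c -> evaluates_to (x ^+ m) (c ^+ m).
Proof.
move=> xc; elim: m => [|m IHm]; first by rewrite !expr0; exact: evaluates_to1.
by rewrite !exprS; exact: evaluates_toM.
Qed.

Lemma evaluates_toZ k x c : evaluates_to x c -> evaluates_to (k *: x) (k * c).
Proof.
have := evaluates_pfrac k%:P; rewrite hornerC => kP xc.
exact: (evaluates_toM kP xc).
Qed.

Lemma ratfun_deriv_pfrac p : ratfun_deriv (pfrac p) = pfrac p^`().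
Proof. by rewrite ratfun_deriv.unlock (frac_deriv_tofrac (@derivM F)). Qed.

Lemma regular_deriv x : regular x -> regular (ratfun_deriv x).
Proof.
move=> [_ [p [q [qb -> _]]]].
pose r := p^`() * q - p * q^`().
exists (r.[b] / (q ^+ 2).[b]), r, (q ^+ 2); split=> //.
  by rewrite horner_exp expf_neq0.
by rewrite ratfun_deriv.unlock (frac_derivE (@derivM F)) // horner_neq0.
Qed.

End Evaluation.

Section Residue.
Variables (F : numFieldType) (b : F).
Local Notation K := (ratfun F).
Local Notation t := (ratfun_t F).
Local Notation u := (t - b%:A : K).
Local Notation D := (@ratfun_deriv F).
Implicit Types (x y g h : K) (p q : {poly F}).

Lemma pfracC (c : F) : pfrac c%:P = c%:A :> K.
Proof. by rewrite [RHS]mulr1. Qed.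

Lemma pfrac_subX (c : F) : pfrac ('X - c%:P) = t - c%:A.
Proof. by rewrite rmorphB /= pfracC. Qed.

Lemma sub_t_neq0 (c : F) : t - c%:A != 0.
Proof. by rewrite -pfrac_subX pfrac_eq0 polyXsubC_eq0. Qed.

Lemma ratfun_deriv_sub_t (c : F) : D (t - c%:A) = 1.
Proof. by rewrite -pfrac_subX ratfun_deriv_pfrac derivXsubC rmorph1. Qed.

Lemma evaluates_sub_t (c : F) : evaluates_to b (t - c%:A) (b - c).
Proof.
by rewrite -pfrac_subX; have := evaluates_pfrac b ('X - c%:P); rewrite !hornerE.
Qed.

Lemma ratfun_derivX x m : D (x ^+ m.+1) = m.+1%:R * x ^+ m * D x.
Proof.
elim: m => [|m IHm]; first by rewrite expr1 mulr1 mul1r.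
by rewrite exprS ratfun_derivM IHm exprS [m.+2%:R]mulrS; ring.
Qed.

Definition nderiv m x : K := iter m D x.

Lemma nderiv_is_linear m : linear (nderiv m).
Proof.
by move=> c x y; rewrite /nderiv; elim: m => //= m ->; rewrite linearP.
Qed.
HB.instance Definition _ m :=
  GRing.isLinear.Build F K K *:%R (nderiv m) (nderiv_is_linear m).

Lemma nderivS m x : nderiv m.+1 x = D (nderiv m x).
Proof. by []. Qed.

Lemma nderivSr m x : nderiv m.+1 x = nderiv m (D x).
Proof. exact: iterSr. Qed.

Lemma regular_nderiv m x : regular b x -> regular b (nderiv m x).
Proof. by move=> rx; elim: m => //= m; exact: regular_deriv. Qed.

Lemma nderiv_mul_sub_t m x :
  nderiv m.+1 (u * x) = u * nderiv m.+1 x + m.+1%:R * nderiv m x.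
Proof.
elim: m => [|m IHm].
  by rewrite nderivS ratfun_derivM ratfun_deriv_sub_t !mul1r addrC.
rewrite nderivS IHm linearD /= ratfun_derivM ratfun_deriv_sub_t !mulr_natl.
rewrite [D (_ *+ _)]linearMn -!nderivS mul1r [_ *+ m.+2]mulrS addrCA addrA.
by congr (_ + _).
Qed.

Lemma eval_nderiv_mul_sub_t m x : regular b x ->
  eval_at b (nderiv m.+1 (u * x)) = m.+1%:R * eval_at b (nderiv m x).
Proof.
move=> rx; apply: eval_atE; rewrite nderiv_mul_sub_t.
have /eval_atP e0 := regular_nderiv m rx.
have /eval_atP e1 := regular_nderiv m.+1 rx.
have := evaluates_toD (evaluates_toM (evaluates_sub_t b) e1)
  (evaluates_toZ m.+1%:R e0).
by rewrite subrr mul0r add0r scaler_nat -[_ *+ m.+1]mulr_natl.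
Qed.

(** The Taylor coefficient of order N of [g] at [b]. Since [g] may vanish at [b], two elements can
    be put over the same power of [u]. *)
Definition residue_is x (c : F) : Prop := exists N g,
  [/\ regular b g, x = g / u ^+ N.+1 & c = eval_at b (nderiv N g) / N`!%:R].

Lemma regular_sub_tM x : regular b x -> regular b (u * x).
Proof.
by move=> [c xc]; eexists; apply: evaluates_toM xc; exact: evaluates_sub_t.
Qed.

Lemma regular_sub_tXM m x : regular b x -> regular b (u ^+ m * x).
Proof.
move=> rx; elim: m => [|m IHm]; first by rewrite mul1r.
by rewrite exprS -mulrA; exact: regular_sub_tM.
Qed.

(** By Leibniz' rule at the zero [b] of [u], multiplication by [u] raises the order of each Taylor
    coefficient by one. Hence the residue does not depend on the power chosen in the denominator. *)
Lemma eval_nderiv_shift N d g : regular b g ->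
  eval_at b (nderiv (d + N) (u ^+ d * g)) / (d + N)`!%:R =
  eval_at b (nderiv N g) / N`!%:R.
Proof.
move=> rg; elim: d => [|d IHd]; first by rewrite !add0n mul1r.
rewrite exprS -mulrA addSn eval_nderiv_mul_sub_t; last exact: regular_sub_tXM.
by rewrite factS natrM -mulf_div divff ?mul1r // pnatr_eq0.
Qed.

Lemma residue_is_fun x c d : residue_is x c -> residue_is x d -> c = d.
Proof.
move=> [N [g [rg -> ->]]] [M [h [rh + ->]]].
wlog: N M g h rg rh / (N <= M)%N.
  move=> H; have [NM|/ltnW MN] := leqP N M; first exact: H.
  by move=> e; symmetry; exact: (H _ _ _ _ _ _ MN).
move=> /subnK <-; move: (M - N)%N => e /eqP.
have u0 m : u ^+ m != 0 by rewrite expf_neq0 // sub_t_neq0.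
rewrite -addnS exprD invfM mulrA (inj_eq (mulIf _)) ?invr_eq0 // => /eqP eg.
by rewrite -[h](mulfVK (u0 e)) -eg [g * _]mulrC eval_nderiv_shift.
Qed.

Lemma laurent_form x :
  exists N0, forall N, (N0 <= N)%N -> exists2 g, regular b g & x = g / u ^+ N.
Proof.
have [q q0 [p ->]]: exists2 q, q != 0 & exists p, x = pfrac p / pfrac q.
  by elim/frac_ind: x => p q q0; exists q => //; exists p.
have [m [r + ->]] := multiplicity_XsubC q b.
rewrite q0 /= => rb; exists m => N /subnK <-.
exists (u ^+ (N - m) * (pfrac p / pfrac r)).
  by apply: regular_sub_tXM; exists (p.[b] / r.[b]), p, r.
rewrite rmorphM rmorphXn /= pfrac_subX exprD invfM.
rewrite (mulrC (u ^+ _)) -!mulrA; congr (_ * _); rewrite invfM; congr (_ * _).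
by rewrite mulVKf // expf_neq0 // sub_t_neq0.
Qed.

Definition residue x : F := xget 0 (residue_is x).

Lemma residueE x c : residue_is x c -> residue x = c.
Proof. by move=> xc; apply: (residue_is_fun _ xc); exact: (xgetI 0 xc). Qed.

Lemma residue_divX N g : regular b g ->
  residue (g / u ^+ N.+1) = eval_at b (nderiv N g) / N`!%:R.
Proof. by move=> rg; apply: residueE; exists N, g. Qed.

Lemma residue_is_linear : scalar residue.
Proof.
move=> c x y; have [N1 H1] := laurent_form x; have [N2 H2] := laurent_form y.
pose N := maxn N1 N2.
have [g rg ->] := H1 N.+1 (leqW (leq_maxl _ _)).
have [h rh ->] := H2 N.+1 (leqW (leq_maxr _ _)).
have /eval_atP eg := regular_nderiv N rg; have /eval_atP eh := regular_nderiv N rh.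
have rgh : regular b (c *: g + h).
  have [[? g1] [? h1]] := (rg, rh).
  by eexists; exact: evaluates_toD (evaluates_toZ c g1) h1.
rewrite scalerAl -mulrDl !residue_divX // linearP.
by rewrite (eval_atE (evaluates_toD (evaluates_toZ c eg) eh)) mulrDl -mulrA.
Qed.
HB.instance Definition _ := GRing.isLinear.Build F K F *%R residue residue_is_linear.

Lemma residue_regular x : regular b x -> residue x = 0.
Proof.
move=> rx; have -> : x = (u * x) / u ^+ 1.
  by rewrite expr1 mulrC mulKf // sub_t_neq0.
rewrite residue_divX; last exact: regular_sub_tM.
have /eval_atP ex := rx.
by rewrite (eval_atE (evaluates_toM (evaluates_sub_t b) ex)) subrr mul0r mul0r.
Qed.

Let quotient_rule_pow (k : fieldType) (w v c e g : k) : w != 0 -> v != 0 ->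
  e / (w * v) + g * - (c * v * 1 * (w * v) ^- 2) =
  (- (c * g) + w * e) / (w * (w * v)).
Proof. by move=> w0 v0; field; rewrite w0 v0. Qed.

(** For x = g / u^(N+1) the derivative is (u g' - (N+1) g) / u^(N+2). At [b] the derivative of order
    N+1 of u g' is N+1 times that of g, so the numerator contributes nothing. *)
Lemma residue_deriv x : residue (D x) = 0.
Proof.
have [N] := laurent_form x; move=> /(_ N.+1 (leqnSn _)) [g rg ->].
have u0 : u != 0 := sub_t_neq0 b.
have -> : D (g / u ^+ N.+1) = (- N.+1%:R *: g + u * D g) / u ^+ N.+2.
  rewrite ratfun_derivM ratfun_derivV ?expf_neq0 // ratfun_derivX.
  rewrite ratfun_deriv_sub_t scaleNr scaler_nat.
  by rewrite ![u ^+ _.+1]exprS quotient_rule_pow ?expf_neq0 // mulr_natl.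
have rDg := regular_deriv rg.
have /eval_atP e1 := regular_nderiv N.+1 (regular_sub_tM rDg).
have /eval_atP e2 := regular_nderiv N.+1 rg.
rewrite residue_divX; last first.
  have [[? g1] [? h1]] := (regular_sub_tM rDg, rg).
  by eexists; exact: evaluates_toD (evaluates_toZ _ h1) g1.
rewrite [nderiv _ _]linearP (eval_atE (evaluates_toD (evaluates_toZ _ e2) e1)).
by rewrite eval_nderiv_mul_sub_t // -nderivSr mulNr addNr mul0r.
Qed.

End Residue.

(** * Generators and residues in R_a *)

Lemma deriv_eq0 (F : numFieldType) (p : {poly F}) :
  p^`() = 0 -> p = (p`_0)%:P.
Proof.
move=> p'0; apply/polyP => -[|m]; rewrite coefC //=.
have := congr1 (fun q : {poly F} => q`_m) p'0; rewrite coef_deriv coef0.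
by move=> /eqP; rewrite mulrn_eq0 /= => /eqP.
Qed.

(** In lowest terms p/q, the equation p' q = p q' forces q to divide q', so q' = 0 by degree and
    then p' = 0; in characteristic zero both are constants. *)
Lemma ratfun_deriv_eq0 (F : numFieldType) (x : ratfun F) :
  ratfun_deriv x = 0 -> exists c : F, x = c%:A.
Proof.
have [p [q [q0 cpq ->]]] : exists p q : {poly F},
  [/\ q != 0, coprimep p q & x = pfrac p / pfrac q].
  elim/frac_ind: x => p q q0.
  pose d := gcdp p q; have d0 : d != 0 by rewrite gcdp_eq0 negb_and q0 orbT.
  exists (p %/ d), (q %/ d); split.
  - by apply: contraNneq q0 => e; rewrite -(divpK (dvdp_gcdr p q)) e mul0r.
  - by rewrite coprimep_div_gcd // q0 orbT.
  - rewrite -[X in FracField.tofrac X / _](divpK (dvdp_gcdl p q)).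
    rewrite -[X in _ / FracField.tofrac X](divpK (dvdp_gcdr p q)) -!/d.
    rewrite -!/(pfrac _) !rmorphM /= -mulf_div divff ?mulr1 //.
    by rewrite pfrac_eq0.
rewrite ratfun_deriv.unlock (frac_derivE (@derivM F)) // => /eqP.
rewrite mulf_eq0 invr_eq0 -!/(pfrac _) !pfrac_eq0 expf_eq0 (negbTE q0) orbF.
rewrite subr_eq0 => /eqP e.
have qq' : q %| q^`().
  by rewrite -(@Gauss_dvdpr _ _ p) 1?coprimep_sym // -e dvdp_mulIr.
have q'0 : q^`() = 0.
  apply/eqP; apply: contraTT qq' => q'0; apply: contraTN (lt_size_deriv q0).
  by rewrite -leqNgt; exact: dvdp_leq.
have p'0 : p^`() = 0.
  by move/eqP: e; rewrite q'0 mulr0 mulf_eq0 (negbTE q0) orbF => /eqP.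
exists (p`_0 / q`_0); have qc := deriv_eq0 q'0.
have q00 : q`_0 != 0 by apply: contraNneq q0 => q00; rewrite qc q00.
rewrite (deriv_eq0 p'0) qc !coefC /=.
apply: (canLR (mulfK _)); first by rewrite pfrac_eq0 polyC_eq0.
by rewrite !pfracC -scalerAl mul1r scalerA divfK.
Qed.

Section Generators.
Variables (F : numFieldType) (n : nat) (a : 'I_n -> F).
Hypothesis a_inj : injective a.
Local Notation R := (Ra a).
Local Notation t := (Ra_t a).
Local Notation D := (@Ra_deriv F n a).
Implicit Types (f g h : R) (p q : {poly F}).

Definition pole i : R := MkRa (Ra_pole_subproof a i).

Lemma pole_mulr i : (t - (a i)%:A) * pole i = 1.
Proof. by apply: val_inj; rewrite /= mulfV // sub_t_neq0. Qed.

Lemma t_mul_pole i : t * pole i = 1 + a i *: pole i.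
Proof.
by rewrite -[in RHS](pole_mulr i) mulrBl -scalerAl mul1r subrK.
Qed.

Let tele_prod (A : comNzRingType) (x y z : A) :
  (x * y - 1) * z - y * (x * z - 1) = y - z.
Proof. ring. Qed.

Lemma pole_mul_pole i j : i != j ->
  pole i * pole j = (a i - a j)^-1 *: (pole i - pole j).
Proof.
move=> ij; have aij : a i - a j != 0 by rewrite subr_eq0 (inj_eq a_inj).
(* After multiplication by a_i - a_j, each [a k *: pole k] becomes [t * pole k - 1], and the
   products containing t cancel. *)
apply: (can_inj (scalerK aij)); rewrite scalerA divff // scale1r scalerBl.
have e k : a k *: pole k = t * pole k - 1 by rewrite t_mul_pole addrC addKr.
by rewrite [a i *: _]scalerAl [a j *: _]scalerAr !e tele_prod.
Qed.

Lemma Ra_val_X f m : Ra_val (f ^+ m) = Ra_val f ^+ m.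
Proof. exact: (rmorphXn (val : R -> ratfun F)). Qed.

Lemma Ra_deriv1 : D 1 = 0.
Proof. by apply: val_inj; rewrite /= ratfun_deriv1. Qed.

Lemma Ra_derivX f m : D (f ^+ m.+1) = m.+1%:R *: (f ^+ m * D f).
Proof.
elim: m => [|m IHm]; first by rewrite expr1 mul1r scale1r.
rewrite exprS Ra_derivM IHm -scalerAr mulrA -exprS [D f * _]mulrC.
by rewrite [m.+2%:R]mulrS scalerDl scale1r.
Qed.

Lemma Ra_deriv_pole i : D (pole i) = - pole i ^+ 2.
Proof.
have := congr1 D (pole_mulr i); rewrite Ra_derivM linearB linearZ /=.
rewrite Ra_deriv_t Ra_deriv1 scaler0 subr0 mul1r => /(congr1 ( *%R (pole i))).
rewrite mulr0 mulrDr mulrA [pole i * (_ - _)]mulrC pole_mulr mul1r => /eqP.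
by rewrite addrC addr_eq0 => /eqP.
Qed.

Lemma Ra_deriv_poleX i m : D (pole i ^+ m) = - m%:R *: pole i ^+ m.+1.
Proof.
case: m => [|m]; first by rewrite Ra_deriv1 oppr0 scale0r.
by rewrite Ra_derivX Ra_deriv_pole mulrN scalerN -scaleNr -exprD addn2.
Qed.

Definition poly_Ra p : R := horner_alg t p.
HB.instance Definition _ := GRing.RMorphism.copy poly_Ra (horner_alg t).

Lemma poly_RaC c : poly_Ra c%:P = c%:A. Proof. exact: horner_algC. Qed.
Lemma poly_RaX : poly_Ra 'X = t. Proof. exact: horner_algX. Qed.

Lemma Ra_val_poly p : Ra_val (poly_Ra p) = pfrac p.
Proof.
elim/poly_ind: p => [|p c IHp]; first by rewrite !rmorph0.
rewrite !rmorphD !rmorphM /= poly_RaX poly_RaC pfracC.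
by congr (_ * _ + _).
Qed.

Lemma Ra_deriv_poly p : D (poly_Ra p) = poly_Ra p^`().
Proof.
by apply: val_inj; rewrite /= !Ra_val_poly ratfun_deriv_pfrac.
Qed.

(** The linear span of the basis, encoded by its induction principle so that no coefficients have to
    be carried along. *)
Definition in_Ra_span f : Prop := forall P : R -> Prop,
  P 0 -> (forall c f g, P f -> P g -> P (c *: f + g)) ->
  (forall k, P (t ^+ k)) -> (forall i l, P (pole i ^+ l.+1)) -> P f.

Lemma in_Ra_spanL c f g :
  in_Ra_span f -> in_Ra_span g -> in_Ra_span (c *: f + g).
Proof. by move=> Sf Sg P P0 PL Pt Pp; apply: (PL); [apply: Sf | apply: Sg]. Qed.

Lemma in_Ra_spanZ c f : in_Ra_span f -> in_Ra_span (c *: f).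
Proof. by move=> Sf; rewrite -[_ *: _]addr0; apply: in_Ra_spanL. Qed.

Lemma in_Ra_spanD f g : in_Ra_span f -> in_Ra_span g -> in_Ra_span (f + g).
Proof. by move=> Sf Sg; rewrite -[f]scale1r; apply: in_Ra_spanL. Qed.

Lemma in_Ra_span_t k : in_Ra_span (t ^+ k). Proof. by []. Qed.
Lemma in_Ra_span_pole i l : in_Ra_span (pole i ^+ l).
Proof. by case: l => [|l] //; exact: (in_Ra_span_t 0). Qed.

Lemma in_Ra_span_mul_t f : in_Ra_span f -> in_Ra_span (t * f).
Proof.
move/(_ (fun f => in_Ra_span (t * f))); apply; first by rewrite mulr0.
- move=> c g h Sg Sh; rewrite mulrDr -scalerAr; exact: in_Ra_spanL.
- by move=> k; rewrite -exprS.
- move=> i l; rewrite exprS mulrA t_mul_pole mulrDl mul1r -scalerAl -exprS.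
  apply: in_Ra_spanD; first exact: in_Ra_span_pole.
  by apply: in_Ra_spanZ; exact: in_Ra_span_pole.
Qed.

Lemma in_Ra_span_mul_pole i f : in_Ra_span f -> in_Ra_span (pole i * f).
Proof.
move/(_ (fun f => in_Ra_span (pole i * f))); apply; first by rewrite mulr0.
- move=> c g h Sg Sh; rewrite mulrDr -scalerAr; exact: in_Ra_spanL.
- elim=> [|k IHk]; first by rewrite mulr1 -[pole i]expr1; exact: in_Ra_span_pole.
  rewrite exprS mulrA [pole i * t]mulrC t_mul_pole mulrDl mul1r -scalerAl.
  apply: in_Ra_spanD; [exact: in_Ra_span_t | exact: in_Ra_spanZ].
- move=> j; have [->|ij] := eqVneq i j.
    by move=> l; rewrite -exprS; exact: in_Ra_span_pole.
  have Sij l : in_Ra_span (pole i * pole j ^+ l) ->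
      in_Ra_span (pole i * pole j ^+ l.+1).
    move=> Sl; rewrite exprS mulrA pole_mul_pole // -scalerAl mulrBl -exprS.
    apply: in_Ra_spanZ; apply: in_Ra_spanD => //.
    by rewrite -scaleN1r; apply: in_Ra_spanZ; exact: in_Ra_span_pole.
  elim=> [|l IHl]; apply: (Sij) => //.
  by rewrite mulr1 -[pole i]expr1; exact: in_Ra_span_pole.
Qed.

(** The span of the basis is stable under multiplication by t and, by partial fractions, by each
    pole, hence by all of R_a; and it contains 1. *)
Lemma Ra_basis_ind (P : R -> Prop) :
  P 0 -> (forall c f g, P f -> P g -> P (c *: f + g)) ->
  (forall k, P (t ^+ k)) -> (forall i l, P (pole i ^+ l.+1)) ->
  forall f, P f.
Proof.
move=> P0 PL Pt Pp f.
suff Sf : in_Ra_span f by exact: Sf.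
suff H g : in_Ra_span g -> in_Ra_span (f * g).
  by rewrite -[f]mulr1; apply: H; exact: (in_Ra_span_t 0).
move: f g; apply: Ra_ind => [g Sg|c f h Sf Sh g Sg|f h Sf Sh g Sg|g Sg|f i fE g Sg].
- by rewrite mul1r.
- by rewrite mulrDl -scalerAl; exact: (in_Ra_spanL c (Sf _ Sg) (Sh _ Sg)).
- by rewrite -mulrA; exact: (Sf _ (Sh _ Sg)).
- exact: in_Ra_span_mul_t.
- have -> : f = pole i by exact: val_inj.
  exact: in_Ra_span_mul_pole.
Qed.

(** In characteristic zero every basis element other than a simple pole has a nonzero multiple that
    is a derivative. *)
Lemma Ra_deriv_ind (P : R -> Prop) :
  (forall c f g, P f -> P g -> P (c *: f + g)) ->
  (forall g, P (D g)) -> (forall i, P (pole i)) -> forall f, P f.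
Proof.
move=> PL PD Pp.
have PDZ c g f : D g = c *: f -> c != 0 -> P f.
  move=> e c0; rewrite -[f](scalerK c0) -e -linearZ; exact: PD.
apply: Ra_basis_ind => //.
- by have := PD 0; rewrite linear0.
- move=> k; apply: (PDZ k.+1%:R (t ^+ k.+1)); last by rewrite pnatr_eq0.
  by rewrite Ra_derivX Ra_deriv_t mulr1.
- move=> i [|l]; first by rewrite expr1.
  apply: (PDZ (- l.+1%:R) (pole i ^+ l.+1)); first exact: Ra_deriv_poleX.
  by rewrite oppr_eq0 pnatr_eq0.
Qed.

Lemma Ra_deriv_eq0 f : D f = 0 -> exists c : F, f = c%:A.
Proof.
move=> /(congr1 (@Ra_val _ _ _)) /ratfun_deriv_eq0[c fc].
by exists c; exact: val_inj.
Qed.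

Definition res i f : F := residue (a i) (Ra_val f).

Lemma res_is_linear i : scalar (res i).
Proof. by move=> c f g; rewrite /res /= linearP. Qed.
HB.instance Definition _ i :=
  GRing.isLinear.Build F R F *%R (res i) (res_is_linear i).

Lemma res_deriv i f : res i (D f) = 0.
Proof. exact: residue_deriv. Qed.

Lemma evaluates_pole i c : c != a i ->
  evaluates_to c (Ra_val (pole i)) (c - a i)^-1.
Proof.
move=> ci; exists 1, ('X - (a i)%:P); split.
- by rewrite !hornerE subr_eq0.
- by rewrite rmorph1 pfrac_subX /= div1r.
- by rewrite hornerC hornerXsubC div1r.
Qed.

Lemma regular_poly c p : regular c (Ra_val (poly_Ra p)).
Proof. by exists p.[c]; rewrite Ra_val_poly; exact: evaluates_pfrac. Qed.

Lemma regularM (c : F) (x y : ratfun F) :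
  regular c x -> regular c y -> regular c (x * y).
Proof. by move=> [d xd] [e ye]; exists (d * e); exact: evaluates_toM. Qed.

Lemma res_regular i f : regular (a i) (Ra_val f) -> res i f = 0.
Proof. exact: residue_regular. Qed.

Lemma regular_poleX i j m : j != i -> regular (a i) (Ra_val (pole j ^+ m)).
Proof.
move=> ji; eexists; rewrite Ra_val_X; apply: evaluates_toX.
by apply: evaluates_pole; rewrite (inj_eq a_inj) eq_sym.
Qed.

Lemma res_mul_poleX i f m : regular (a i) (Ra_val f) ->
  res i (f * pole i ^+ m.+1) = eval_at (a i) (nderiv m (Ra_val f)) / m`!%:R.
Proof. by move=> rf; rewrite -residue_divX // /res /= Ra_val_X exprVn. Qed.

Lemma res_pole i j : res i (pole j) = (i == j)%:R.
Proof.
have [<-|ij] := eqVneq i j.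
  have r1 : evaluates_to (a i) (Ra_val (1 : R)) 1 by exact: evaluates_to1.
  rewrite -[pole i]mul1r -[pole i]expr1 res_mul_poleX; last by exists 1.
  by rewrite /nderiv /= (eval_atE r1) divr1.
by apply: res_regular; rewrite -[pole j]expr1; apply: regular_poleX; rewrite eq_sym.
Qed.

Lemma antiderivative f : exists g, f = D g + \sum_i res i f *: pole i.
Proof.
move: f; apply: Ra_deriv_ind => [c f k [g fE] [h kE]|g|i].
- exists (c *: g + h); rewrite {1}fE {1}kE linearP scalerDr -!addrA; congr (_ + _).
  rewrite addrCA; congr (_ + _); rewrite scaler_sumr -big_split /=.
  by apply: eq_bigr => i _; rewrite linearP scalerDl scalerA.
- by exists g; rewrite big1 ?addr0 // => i _; rewrite res_deriv scale0r.
- exists 0; rewrite linear0 add0r (bigD1 i) //= res_pole eqxx scale1r.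
  by rewrite big1 ?addr0 // => j ji; rewrite res_pole (negbTE ji) scale0r.
Qed.

End Generators.

(** * Rigidity of cocycles *)

Section UnbundledLinear.
Variables (F : fieldType) (U V : lmodType F) (h : U -> V).
Hypothesis hL : linear h.

Let hlin : {linear U -> V} := HB.pack h (GRing.isLinear.Build F U V *:%R h hL).

Lemma lin0 : h 0 = 0. Proof. exact: (linear0 hlin). Qed.
Lemma linD x y : h (x + y) = h x + h y. Proof. exact: (linearD hlin). Qed.
Lemma linN x : h (- x) = - h x. Proof. exact: (linearN hlin). Qed.
Lemma linB x y : h (x - y) = h x - h y. Proof. exact: (linearB hlin). Qed.
Lemma linZ c x : h (c *: x) = c *: h x. Proof. exact: (linearZ_LR hlin). Qed.
Lemma lin_sum I (r : seq I) (f : I -> U) :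
  h (\sum_(i <- r) f i) = \sum_(i <- r) h (f i).
Proof. exact: (linear_sum hlin). Qed.
End UnbundledLinear.

Section Cocycles.
Variables (F : numFieldType) (n : nat) (a : 'I_n -> F).
Hypothesis a_inj : injective a.
Local Notation R := (Ra a).
Local Notation t := (Ra_t a).
Local Notation D := (@Ra_deriv F n a).
Local Notation x_ := (pole a).
Local Notation polyR := (poly_Ra a).

Implicit Types (f g h : R) (p q : {poly F}).

Definition wronskian f g : R := f * D g - g * D f.

Lemma wronskianC f g : wronskian f g = - wronskian g f.
Proof. by rewrite /wronskian opprB. Qed.

Lemma wronskian1l f : wronskian 1 f = D f.
Proof. by rewrite /wronskian mul1r Ra_deriv1 mulr0 subr0. Qed.

Lemma wronskian1r f : wronskian f 1 = - D f.
Proof. by rewrite wronskianC wronskian1l. Qed.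

Lemma wronskianDl f g h : wronskian (f + g) h = wronskian f h + wronskian g h.
Proof. by rewrite /wronskian linearD mulrDl mulrDr opprD addrACA. Qed.

Lemma wronskian_t_tX m : wronskian t (t ^+ m.+1) = m%:R *: t ^+ m.+1.
Proof.
rewrite /wronskian Ra_derivX Ra_deriv_t !mulr1 -scalerAr -exprS.
by rewrite [m.+1%:R]mulrS scalerDl scale1r addrC addKr.
Qed.

Lemma Ra_deriv_sub_t c : D (t - c%:A) = 1.
Proof. by rewrite linearB linearZ_LR /= Ra_deriv_t Ra_deriv1 scaler0 subr0. Qed.

Lemma wronskian_sub_t_poleX i l :
  wronskian (t - (a i)%:A) (x_ i ^+ l) = - l.+1%:R *: x_ i ^+ l.
Proof.
rewrite /wronskian Ra_deriv_poleX Ra_deriv_sub_t mulr1 -scalerAr exprS mulrA.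
by rewrite pole_mulr mul1r [l.+1%:R]mulrS addrC opprD scalerDl scaleN1r.
Qed.

Lemma wronskian_pole_t i :
  wronskian (x_ i) t = 2%:R *: x_ i - a i *: D (x_ i).
Proof.
rewrite /wronskian Ra_deriv_t mulr1 Ra_deriv_pole mulrN opprK expr2 mulrA.
rewrite t_mul_pole mulrDl mul1r addrA -scalerAl scalerN opprK.
by rewrite scaler_nat mulr2n.
Qed.

Let cancel_powers (A : comNzRingType) (u x C dC : A) k : u * x = 1 ->
  (u ^+ k.+1 * C) * (- k%:R * x ^+ k.+1) -
    x ^+ k * (k.+1%:R * u ^+ k * C + u ^+ k.+1 * dC) =
  - k%:R * C - k.+1%:R * C - u * dC.
Proof.
move=> ux; have e m : u ^+ m * x ^+ m = 1 by rewrite -exprMn ux expr1n.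
have -> : (u ^+ k.+1 * C) * (- k%:R * x ^+ k.+1) -
    x ^+ k * (k.+1%:R * u ^+ k * C + u ^+ k.+1 * dC) =
  - k%:R * C * (u ^+ k.+1 * x ^+ k.+1) - k.+1%:R * C * (u ^+ k * x ^+ k) -
    u * dC * (u ^+ k * x ^+ k) by rewrite [u ^+ k.+1]exprS; ring.
by rewrite !e !mulr1.
Qed.

(** A zero of order k + 1 at a_i absorbs the pole and the derivative of the pole. Such brackets are
    polynomials, which the normalised cocycle below annihilates. *)
Lemma wronskian_poly_pole i k p : exists q,
  wronskian (polyR (('X - (a i)%:P) ^+ k.+1 * p)) (x_ i ^+ k) = polyR q.
Proof.
exists (- k%:R * p - k.+1%:R * p - ('X - (a i)%:P) * p^`()).
have uE : polyR ('X - (a i)%:P) = t - (a i)%:A.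
  by rewrite rmorphB /= poly_RaX poly_RaC.
rewrite /wronskian rmorphM rmorphXn /= uE Ra_derivM Ra_derivX Ra_deriv_sub_t mulr1.
rewrite Ra_deriv_poly Ra_deriv_poleX.
rewrite -[- k%:R *: _]mulr_algl -[k.+1%:R *: _]mulr_algl scaleNr !scaler_nat.
rewrite cancel_powers ?pole_mulr //.
by rewrite !rmorphB !rmorphM !rmorphN !rmorph_nat /= uE.
Qed.

Variables (E : lmodType F) (eta : R -> R -> E).
Hypothesis etaL : forall f, linear (eta f).
Hypothesis etaN : forall f g, eta f g = - eta g f.
Hypothesis etaJ : forall f g h, eta f (wronskian g h) +
  eta g (wronskian h f) + eta h (wronskian f g) = 0.
Hypothesis eta1 : forall f, eta 1 f = 0.
Hypothesis etat : forall i, eta t (x_ i) = 0.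
Hypothesis etat3 : forall i, eta (t ^+ 3) (x_ i) = 0.

Let etaD f g h : eta f (g + h) = eta f g + eta f h. Proof. exact: linD. Qed.
Let etaB f g h : eta f (g - h) = eta f g - eta f h. Proof. exact: linB. Qed.
Let etaNr f g : eta f (- g) = - eta f g. Proof. exact: linN. Qed.
Let etaZ c f g : eta f (c *: g) = c *: eta f g. Proof. exact: linZ. Qed.
Let eta0 f : eta f 0 = 0. Proof. exact: lin0. Qed.

Lemma cocycle_deriv f g : eta g (D f) = eta f (D g).
Proof.
have := etaJ 1 g f; rewrite eta1 add0r wronskian1r wronskian1l etaNr => /eqP.
by rewrite addrC subr_eq0 => /eqP ->.
Qed.

Lemma cocycle_t f : eta t f = 0.
Proof.
move: f; apply: (Ra_deriv_ind a_inj) => [c f g f0 g0|g|//].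
  by rewrite etaL f0 g0 scaler0 addr0.
by rewrite cocycle_deriv Ra_deriv_t etaN eta1 oppr0.
Qed.

Lemma cocycle_tX k f : eta (t ^+ k) f = 0.
Proof.
elim: k f => [|k IHk]; first exact: eta1.
have tD g : eta (t ^+ k.+1) (D g) = 0.
  rewrite cocycle_deriv Ra_derivX Ra_deriv_t mulr1 etaZ etaN IHk.
  by rewrite oppr0 scaler0.
apply: (Ra_deriv_ind a_inj) => [c f g f0 g0|//|i].
  by rewrite etaL f0 g0 scaler0 addr0.
(* This yields (2 - k) eta(t^(k+1), x_i) = 0, which is empty at k = 2; there the normalisation
   [etat3] supplies the value on t^3. *)
have := etaJ t (t ^+ k.+1) (x_ i).
rewrite cocycle_t add0r wronskian_pole_t wronskian_t_tX etaB !etaZ tD.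
rewrite scaler0 subr0 [eta (x_ i) _]etaN scalerN -scalerBl => /eqP.
have [->|k2] := eqVneq k 2; first by rewrite etat3.
by rewrite scaler_eq0 subr_eq0 eqr_nat eq_sym (negbTE k2) => /eqP.
Qed.

Lemma cocycle_poly p f : eta (polyR p) f = 0.
Proof.
(* The extra factor t^k absorbs the X of p = q X + c in the induction. *)
suff H k : eta f (t ^+ k * polyR p) = 0.
  by rewrite etaN -[polyR p]mul1r (H 0) oppr0.
elim/poly_ind: p k => [|p c IHp] k; first by rewrite rmorph0 mulr0 eta0.
rewrite rmorphD rmorphM /= poly_RaX poly_RaC mulrDr etaD.
rewrite [polyR p * _]mulrC mulrA -exprSr IHp add0r -scalerAr mulr1 etaZ.
by rewrite etaN cocycle_tX oppr0 scaler0.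
Qed.

(** In the cocycle identity with [polyR p] the first term vanishes, because polynomials lie in the
    radical of [eta]; what remains is invariance under polynomial vector fields. *)
Lemma cocycle_wronskian_poly p f g :
  eta f (wronskian (polyR p) g) = - eta (wronskian (polyR p) f) g.
Proof.
have := etaJ (polyR p) f g; rewrite cocycle_poly add0r wronskianC etaNr.
by rewrite [eta g _]etaN => /eqP; rewrite -opprD oppr_eq0 addr_eq0 => /eqP.
Qed.

Lemma cocycle_poleX i j k l : eta (x_ i ^+ k) (x_ j ^+ l.+1) = 0.
Proof.
have XE (c : F) : polyR ('X - c%:P) = t - c%:A.
  by rewrite rmorphB /= poly_RaX poly_RaC.
have [->|ij] := eqVneq i j.
  (* Both powers are eigenvectors of the bracket with t - a_j, with eigenvalues -(k+1) and -(l+2),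
     whose sum is nonzero. *)
  have := cocycle_wronskian_poly ('X - (a j)%:P) (x_ j ^+ k) (x_ j ^+ l.+1).
  rewrite XE !wronskian_sub_t_poleX etaZ [eta (_ *: _) _]etaN etaZ.
  rewrite [eta (x_ j ^+ l.+1) _]etaN opprK scalerN !scaleNr opprK.
  move=> /eqP; rewrite eq_sym -addr_eq0 -scalerDl scaler_eq0 -natrD pnatr_eq0.
  by rewrite addn_eq0 /= => /eqP.
pose v : {poly F} := 'X - (a j)%:P.
have /Bezout_eq1_coprimepP[[A B] /= AB1] :
    coprimep (('X - (a i)%:P) ^+ k.+1) (v ^+ l.+2).
  apply/coprimep_expl/coprimep_expr.
  by rewrite coprimep_XsubC root_XsubC (inj_eq a_inj) eq_sym.
(* [p] is congruent to [v] at a_j and to 0 at a_i. *)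
pose p := ('X - (a i)%:P) ^+ k.+1 * (A * v).
have vE : v = p + v ^+ l.+2 * (v * B).
  by rewrite /p -[LHS]mul1r -AB1; ring.
have [q1 q1E] := wronskian_poly_pole i k (A * v).
have [q2 q2E] := wronskian_poly_pole j l.+1 (v * B).
(* Bracketing with [p] takes x_i^k to a polynomial and x_j^(l+1) to -(l+2) x_j^(l+1) modulo
   polynomials, so invariance leaves (l+2) eta(x_i^k, x_j^(l+1)) = 0. *)
have := cocycle_wronskian_poly p (x_ i ^+ k) (x_ j ^+ l.+1).
rewrite /p q1E cocycle_poly oppr0 -/p.
have -> : wronskian (polyR p) (x_ j ^+ l.+1) =
    - l.+2%:R *: x_ j ^+ l.+1 - polyR q2.
  by rewrite -wronskian_sub_t_poleX -XE -/v [in RHS]vE rmorphD wronskianDl -q2E addrK.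
rewrite etaB etaZ [eta _ (polyR _)]etaN cocycle_poly oppr0 subr0 => /eqP.
by rewrite scaler_eq0 oppr_eq0 pnatr_eq0 => /eqP.
Qed.

Lemma cocycle_eq0 f g : eta f g = 0.
Proof.
have tX h k : eta h (t ^+ k) = 0 by rewrite etaN cocycle_tX oppr0.
move: g; apply: (Ra_basis_ind a_inj) => [|c g h g0 h0|k|j l //].
- by rewrite eta0.
- by rewrite etaL g0 h0 scaler0 addr0.
- exact: tX.
rewrite etaN; apply/eqP; rewrite oppr_eq0; apply/eqP.
move: f; apply: (Ra_basis_ind a_inj) => [|c g h g0 h0|k|i k].
- by rewrite eta0.
- by rewrite etaL g0 h0 scaler0 addr0.
- exact: tX.
- exact: cocycle_poleX.
Qed.

End Cocycles.

Arguments wronskian {F n a} f g.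

(** * The residue cocycle *)

Section IntegerPowers.
Variables (F : numFieldType) (b : F).
Local Notation K := (ratfun F).
Local Notation u := (ratfun_t F - b%:A : K).

Lemma ratfun_deriv_exprz (z : int) : ratfun_deriv (u ^ z) = z%:~R *: u ^ (z - 1).
Proof.
have u0 := sub_t_neq0 b.
have natP m : ratfun_deriv (u ^+ m) = m%:R *: u ^ (m%:Z - 1).
  case: m => [|m]; first by rewrite ratfun_deriv1 scale0r.
  rewrite ratfun_derivX ratfun_deriv_sub_t mulr1 mulr_natl.
  have -> : m.+1%:Z - 1 = m by lia.
  by rewrite scaler_nat.
case: z => m; first exact: natP.
rewrite NegzE -exprnN ratfun_derivV ?expf_neq0 // natP.
rewrite mulrNz scaleNr; congr (- _); rewrite -scalerAl; congr (_ *: _).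
by rewrite -exprM exprnN -expfzDr //; congr (_ ^ _); lia.
Qed.

(** For z other than -1, (z + 1) u^z is the derivative of u^(z+1). *)
Lemma residue_exprz (z : int) : residue b (u ^ z) = (z == -1)%:R.
Proof.
have u0 := sub_t_neq0 b; have [->|z1] := eqVneq z (-1).
  have -> : u ^ (-1) = 1 / u ^+ 1 by rewrite div1r.
  rewrite residue_divX; last by exists 1; exact: evaluates_to1.
  by rewrite /nderiv /= (eval_atE (evaluates_to1 b)) divr1.
have z10 : ((z + 1)%:~R : F) != 0.
  by rewrite intr_eq0; apply: contraNneq z1 => e; apply/eqP; lia.
apply: (mulfI z10); rewrite mulr0 -linearZ_LR /=.
have -> : (z + 1)%:~R *: u ^ z = ratfun_deriv (u ^ (z + 1)).
  by rewrite ratfun_deriv_exprz addrK.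
exact: residue_deriv.
Qed.

Lemma nderiv_pfrac m (p : {poly F}) : nderiv m (pfrac p) = pfrac p^`(m).
Proof. by elim: m => [//|m IHm]; rewrite nderivS IHm ratfun_deriv_pfrac derivnS. Qed.

End IntegerPowers.

Section ResidueCocycle.
Variables (F : numFieldType) (n : nat) (a : 'I_n -> F).
Hypothesis a_inj : injective a.
Local Notation R := (Ra a).
Local Notation t := (Ra_t a).
Local Notation D := (@Ra_deriv F n a).
Local Notation x_ := (pole a).
Local Notation polyR := (poly_Ra a).
Implicit Types (f g h : R) (p q : {poly F}).

(** The Virasoro cocycle localised at a_i, without the customary factor 1/12, written on coefficient
    functions instead of derivations. *)
Definition psi (i : 'I_n) f g : F := res i (D (D (D f)) * g).

Lemma psi_linearr i f : scalar (psi i f).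
Proof. by move=> c g h; rewrite /psi mulrDr -scalerAr linearP. Qed.

Lemma psi_linearl i g : scalar (psi i ^~ g).
Proof. by move=> c f h; rewrite /psi !linearP mulrDl -scalerAl linearP. Qed.

(** Integration by parts: the symmetric part of the form is exact, so its residue vanishes and [psi]
    is skew-symmetric. *)
Let symmetric_part (A : comNzRingType) (d : A -> A)
    (dD : {morph d : x y / x + y}) (dN : {morph d : x / - x})
    (dM : forall x y, d (x * y) = d x * y + x * d y) (f g : A) :
  d (d (d f)) * g + d (d (d g)) * f = d (d (d f) * g - d f * d g + f * d (d g)).
Proof. by rewrite !(dD, dN, dM); ring. Qed.

Lemma psiC i f g : psi i f g = - psi i g f.
Proof.
apply/eqP; rewrite -addr_eq0 -raddfD; apply/eqP.
rewrite (symmetric_part (linearD D) (linearN D) (@Ra_derivM _ _ a)).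
exact: res_deriv.
Qed.

(** The antiderivative on the right is the Wronskian determinant of f, g, h expanded along second
    derivatives. *)
Let cyclic_sum (A : comNzRingType) (d : A -> A)
    (dD : {morph d : x y / x + y}) (dN : {morph d : x / - x})
    (dM : forall x y, d (x * y) = d x * y + x * d y) (f g h : A) :
  d (d (d f)) * (g * d h - h * d g) + d (d (d g)) * (h * d f - f * d h) +
  d (d (d h)) * (f * d g - g * d f) =
  d (d (d f) * (g * d h - h * d g) + d (d g) * (h * d f - f * d h) +
     d (d h) * (f * d g - g * d f)).
Proof. by rewrite !(dD, dN, dM); ring. Qed.

Lemma psiJ i f g h : psi i f (wronskian g h) + psi i g (wronskian h f) +
  psi i h (wronskian f g) = 0.
Proof.
rewrite -!raddfD (cyclic_sum (linearD D) (linearN D) (@Ra_derivM _ _ a)).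
exact: res_deriv.
Qed.

Lemma psi_poly i p q : psi i (polyR p) (polyR q) = 0.
Proof. by rewrite /psi !Ra_deriv_poly -rmorphM; apply/res_regular/regular_poly. Qed.

Lemma poly_RaXn k : polyR 'X^k = t ^+ k.
Proof. by rewrite rmorphXn /= poly_RaX. Qed.

Lemma regular_valM c f g :
  regular c (Ra_val f) -> regular c (Ra_val g) -> regular c (Ra_val (f * g)).
Proof. exact: regularM. Qed.

Lemma psi_t_regular i j k l : j != i -> psi i (t ^+ k) (x_ j ^+ l) = 0.
Proof.
move=> ji; rewrite /psi -poly_RaXn !Ra_deriv_poly.
by apply: res_regular; apply: regular_valM; [exact: regular_poly | exact: regular_poleX].
Qed.

(** The residue is the Taylor coefficient of order m of (X^k)''' at a_i, that is C(k, m+3)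
    (m+3)(m+2)(m+1) a_i^(k-m-3). With l = m+2 the product of three factors is l^3 - l. Truncation of
    the exponent is harmless, as the binomial coefficient is then zero. *)
Lemma psi_t_pole i k m : psi i (t ^+ k) (x_ i ^+ m.+1) =
  'C(k, m.+3)%:R * a i ^+ (k - m.+3) * (m.+2%:R ^+ 3 - m.+2%:R).
Proof.
rewrite /psi -poly_RaXn !Ra_deriv_poly res_mul_poleX; last exact: regular_poly.
rewrite Ra_val_poly nderiv_pfrac -!derivSn (eval_atE (evaluates_pfrac _ _)).
rewrite derivnXn hornerMn hornerXn -bin_ffact -mulr_natr natrM.
have fm0 : m`!%:R != 0 :> F by rewrite pnatr_eq0 -lt0n fact_gt0.
apply: (canLR (mulfK fm0)); rewrite !factS !natrM -![m.+1%:R]natr1.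
by rewrite -![m.+2%:R]natr1 -![m.+3%:R]natr1 -![m.+2%:R]natr1 -![m.+1%:R]natr1; ring.
Qed.

Lemma eval_nderiv_poleX i j l m : j != i ->
  eval_at (a i) (nderiv m (Ra_val (x_ j ^+ l.+1))) =
  (-1) ^+ m * (l + m)`!%:R / l`!%:R * (a i - a j) ^- (l + m).+1.
Proof.
move=> ji; have -> : nderiv m (Ra_val (x_ j ^+ l.+1)) =
  ((-1) ^+ m * (l + m)`!%:R / l`!%:R) *: Ra_val (x_ j ^+ (l + m).+1).
  elim: m => [|m IHm].
    by rewrite !addn0 mul1r divff ?scale1r // pnatr_eq0 -lt0n fact_gt0.
  rewrite nderivS IHm linearZ_LR /= -[ratfun_deriv _]/(Ra_val (D (x_ j ^+ _))).
  rewrite Ra_deriv_poleX -[Ra_val (- _ *: _)]/(- _ *: Ra_val _) scalerA addnS.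
  by congr (_ *: _); rewrite factS natrM exprS; ring.
have ev : evaluates_to (a i) (Ra_val (x_ j)) (a i - a j)^-1.
  by apply: evaluates_pole; rewrite (inj_eq a_inj) eq_sym.
rewrite Ra_val_X (eval_atE (evaluates_toZ _ (evaluates_toX _ ev))).
by rewrite exprVn.
Qed.

Lemma Ra_deriv3_poleX i k : D (D (D (x_ i ^+ k.+1))) =
  - (k.+1%:R * k.+2%:R * k.+3%:R) *: x_ i ^+ k.+4.
Proof.
have DZ c f : D (c *: f) = c *: D f by exact: linearZ_LR.
by rewrite !(Ra_deriv_poleX, DZ) !scalerA; congr (_ *: _); ring.
Qed.

(** The third derivative of x_i^(k+1) is -(k+1)(k+2)(k+3) x_i^(k+4), so the residue involves the
    Taylor coefficient of order k+3 of x_j^(l+1) at a_i; the three factors turn 1/(k+3)! into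
    1/k!. *)
Lemma psi_pole_pole i j k l : j != i ->
  psi i (x_ i ^+ k.+1) (x_ j ^+ l.+1) =
  (k + l + 3)`!%:R /
    (k`!%:R * l`!%:R * (a j - a i) ^+ k.+2 * (a i - a j) ^+ l.+2).
Proof.
move=> ji; rewrite /psi Ra_deriv3_poleX -scalerAl linearZ_LR /= mulrC.
rewrite [x_ i ^+ _ * _]mulrC res_mul_poleX; last exact: regular_poleX.
rewrite eval_nderiv_poleX //.
have fm0 m : m`!%:R != 0 :> F by rewrite pnatr_eq0 -lt0n fact_gt0.
have aij : a i - a j != 0 by rewrite subr_eq0 (inj_eq a_inj) eq_sym.
have -> : (k + l + 3 = l + k.+3)%N by lia.
(* The outer minus cancels that of the third derivative; the remaining sign (-1)^(k+2) goes to the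
   denominator and turns (a_i - a_j)^(k+2) into (a_j - a_i)^(k+2). *)
have -> : (-1) ^+ k.+3 = - ((-1) ^+ k.+2)^-1 :> F.
  by rewrite exprS mulN1r -exprVn invrN invr1.
have -> : a j - a i = -1 * (a i - a j) by rewrite mulN1r opprB.
have -> : ((l + k.+3).+1 = k.+2 + l.+2)%N by lia.
have -> : k.+3`! = (k.+3 * k.+2 * k.+1 * k`!)%N by rewrite !factS !mulnA.
rewrite !natrM exprMn exprD.
have e0 : (-1) ^+ k.+2 != 0 :> F by rewrite expf_neq0 // oppr_eq0 oner_eq0.
have S0 m : m.+1%:R != 0 :> F by rewrite pnatr_eq0.
move: (expf_neq0 k.+2 aij) (expf_neq0 l.+2 aij).
move: (_ ^+ k.+2) (_ ^+ k.+2) (_ ^+ l.+2) e0.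
move: (fm0 k) (fm0 l) (S0 k) (S0 k.+1) (S0 k.+2).
move: k`!%:R l`!%:R k.+1%:R k.+2%:R k.+3%:R (l + k.+3)`!%:R.
by move=> *; field; do ?[apply/andP; split].
Qed.

Lemma psi_pole_same i k l : psi i (x_ i ^+ k.+1) (x_ i ^+ l.+1) = 0.
Proof.
rewrite /psi Ra_deriv3_poleX -scalerAl linearZ_LR /= -exprD /res Ra_val_X.
by rewrite exprVn exprnN residue_exprz mulr0.
Qed.

Lemma psi_pole_regular i j m k l : j != i -> m != i ->
  psi i (x_ j ^+ k) (x_ m ^+ l) = 0.
Proof.
move=> ji mi; apply: res_regular; apply: regular_valM; last exact: regular_poleX.
by apply/regular_deriv/regular_deriv/regular_deriv/regular_poleX.
Qed.

End ResidueCocycle.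

(** * Identification of phi_i with the residue cocycle *)

Section PhiIsResidue.
Variables (F : numFieldType) (n : nat) (a : 'I_n -> F).
Hypothesis a_inj : injective a.
Local Notation R := (Ra a).
Local Notation t := (Ra_t a).
Local Notation D := (@Ra_deriv F n a).
Local Notation x_ := (pole a).
Local Notation polyR := (poly_Ra a).
Local Notation vf := (@vf F n a).
Implicit Types (f g h : R) (p q : {poly F}).

Lemma Ra_basisP f : Ra_basis f ->
  (exists k, f = t ^+ k) \/ exists i l, f = x_ i ^+ l.+1.
Proof.
case=> [[k fk]|[i [[|l] [// _ fl]]]]; [left; exists k|right; exists i, l].
  by apply: val_inj; rewrite [RHS]Ra_val_X.
by apply: val_inj; rewrite [RHS]Ra_val_X exprVn.
Qed.

(** For l = 0 and l = 1 both arguments are polynomials and l^3 - l vanishes; for l at least 2 the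
    second argument is a negative power and [psi_t_pole] applies. *)
Lemma psi_neq0_value i f g k l :
  Ra_val f = ratfun_t F ^ (k%:Z + 1) ->
  Ra_val g = (ratfun_t F - (a i)%:A) ^ (- l%:Z + 1) ->
  psi i f g = 'C(k + 1, l + 1)%:R * a i ^ (k%:Z - l%:Z) * (l%:R ^+ 3 - l%:R).
Proof.
move=> fE gE; have {fE}-> : f = polyR 'X^(k.+1).
  rewrite poly_RaXn; apply: val_inj; rewrite [RHS]Ra_val_X [LHS]fE.
  by have -> : k%:Z + 1 = k.+1 by lia.
have XE : polyR ('X - (a i)%:P) = t - (a i)%:A.
  by rewrite rmorphB /= poly_RaX poly_RaC.
case: l gE => [|[|l]] gE.
- have -> : g = polyR ('X - (a i)%:P) by rewrite XE; exact: val_inj.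
  by rewrite psi_poly [X in _ * X](_ : _ = 0) ?mulr0 // expr0n subr0.
- have -> : g = polyR 1 by rewrite rmorph1; exact: val_inj.
  by rewrite psi_poly expr1n subrr mulr0.
have -> : g = x_ i ^+ l.+1.
  apply: val_inj; rewrite [LHS]gE [RHS]Ra_val_X exprVn exprnN.
  by congr (_ ^ _); lia.
rewrite poly_RaXn psi_t_pole !addn1.
(* When the integer exponent of a_i is negative it differs from the truncated one, but the binomial
   coefficient is zero. *)
have [kl|lk] := ltnP k l.+2; first by rewrite bin_small ?mul0r.
by have -> : k%:Z - l.+2%:Z = (k.+1 - l.+3)%N by lia.
Qed.

(** Both arguments are powers of t - a_i, so the residue is that of (k+1) k (k-1) (t -
    a_i)^(k-l-1). *)
Lemma psi_eq0_value i f g (k l : int) : a i = 0 ->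
  Ra_val f = ratfun_t F ^ (k + 1) ->
  Ra_val g = (ratfun_t F - (a i)%:A) ^ (- l + 1) ->
  psi i f g = (k == l)%:R * (l%:~R ^+ 3 - l%:~R).
Proof.
move=> ai0 fE gE; rewrite /psi /res.
have {}fE : Ra_val f = (ratfun_t F - (a i)%:A) ^ (k + 1).
  by rewrite fE ai0 scale0r subr0.
have DZ c (x : ratfun F) : ratfun_deriv (c *: x) = c *: ratfun_deriv x.
  exact: linearZ_LR.
rewrite /= fE gE !(ratfun_deriv_exprz, DZ) !scalerA -scalerAl linearZ_LR /=.
rewrite -expfzDr ?sub_t_neq0 // residue_exprz.
have -> : (k + 1 - 1 - 1 - 1 + (- l + 1) == -1) = (k == l) by lia.
have [->|_] := eqVneq; last by rewrite mulr0 mul0r.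
by rewrite mulr1 mul1r !(rmorphD, rmorphN) /= !rmorph1; ring.
Qed.

Lemma psi_poles_value i j f g k l : j != i -> (0 < k)%N -> (0 < l)%N ->
  Ra_val f = (ratfun_t F - (a i)%:A) ^- k ->
  Ra_val g = (ratfun_t F - (a j)%:A) ^- l ->
  psi i f g = ((k + l + 1)`!)%:R /
    (((k - 1)`!)%:R * ((l - 1)`!)%:R *
       (a j - a i) ^+ (k + 1) * (a i - a j) ^+ (l + 1)).
Proof.
case: k => // k; case: l => // l ji _ _ fE gE.
have -> : f = x_ i ^+ k.+1.
  by apply: val_inj; rewrite [LHS]fE [RHS]Ra_val_X exprVn.
have -> : g = x_ j ^+ l.+1.
  by apply: val_inj; rewrite [LHS]gE [RHS]Ra_val_X exprVn.
rewrite psi_pole_pole // !subn1 !addn1 /=.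
by have -> : (k + l + 3 = (k.+1 + l.+1).+1)%N by lia.
Qed.

Lemma phi_value_psi i f g c : phi_value i f g c -> psi i f g = c.
Proof.
case=> {f g c} f g; first by move=> k l _; exact: psi_neq0_value.
- by move=> k l; exact: psi_eq0_value.
- by move=> j k l; exact: psi_poles_value.
Qed.

(** The second alternative serves t^0: for nonzero a_i the table starts at t^1, while the third
    derivative of t^0 vanishes. *)
Lemma t_pole_phi_value i k l : (exists c, phi_value i (t ^+ k) (x_ i ^+ l.+1) c)
  \/ psi i (t ^+ k) (x_ i ^+ l.+1) = 0.
Proof.
case: k => [|k]; first by right; rewrite psi_t_pole bin0n !mul0r.
left; have fE : Ra_val (t ^+ k.+1) = ratfun_t F ^ (k%:Z + 1).
  by rewrite Ra_val_X; have -> : k%:Z + 1 = k.+1 by lia.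
have gE : Ra_val (x_ i ^+ l.+1) = (ratfun_t F - (a i)%:A) ^ (- l.+2%:Z + 1).
  by rewrite Ra_val_X exprVn exprnN; congr (_ ^ _); lia.
have [ai0|ai0] := eqVneq (a i) 0; eexists.
  exact: (Phi_eq0 ai0 fE gE).
exact: (Phi_neq0 ai0 fE gE).
Qed.

Lemma pole_pole_phi_value i j k l : j != i ->
  exists c, phi_value i (x_ i ^+ k.+1) (x_ j ^+ l.+1) c.
Proof.
move=> ji; eexists; apply: (Phi_poles (k := k.+1) (l := l.+1) ji) => //.
- by rewrite Ra_val_X exprVn.
- by rewrite Ra_val_X exprVn.
Qed.

Lemma psi_no_value i f g : Ra_basis f -> Ra_basis g ->
  (forall c, ~ phi_value i f g c) -> (forall c, ~ phi_value i g f c) ->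
  psi i f g = 0.
Proof.
have tp k j l : (forall c, ~ phi_value i (t ^+ k) (x_ j ^+ l.+1) c) ->
    psi i (t ^+ k) (x_ j ^+ l.+1) = 0.
  have [-> H|ji _] := eqVneq j i; last exact: psi_t_regular.
  by have [[c /H]|] := t_pole_phi_value i k l.
move=> /Ra_basisP[[k ->]|[j [k ->]]] /Ra_basisP[[l ->]|[m [l ->]]] H1 H2.
- by rewrite -!poly_RaXn psi_poly.
- exact: tp.
- by rewrite psiC tp ?oppr0.
- have [ji|ji] := eqVneq j i; have [mi|mi] := eqVneq m i.
  + by rewrite ji mi psi_pole_same.
  + by rewrite ji in H1; have [c /H1] := pole_pole_phi_value k l mi.
  + by rewrite mi in H2; have [c /H2] := pole_pole_phi_value l k ji.
  + exact: psi_pole_regular.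
Qed.

(** The coefficient of a derivation is its value at t, by [Der_vf]. Together with [phi_spec_unique]
    this determines the form that [phi] obtains by choice. *)
Lemma psi_phi_spec i : phi_spec i (fun A B : Der a => psi i (A t) (B t)).
Proof.
have vf_t f : vf f t = f by rewrite /= Ra_deriv_t mulr1.
split.
- by split=> [A|B] c A1 A2; [exact: psi_linearr | exact: psi_linearl].
- by move=> A B; exact: psiC.
- by move=> f g c; rewrite !vf_t; exact: phi_value_psi.
- by move=> f g; rewrite !vf_t; exact: psi_no_value.
Qed.

Lemma vf_linear : linear vf.
Proof.
move=> c f g; apply: val_inj; apply/funext => h.
rewrite -[LHS]/((c *: f + g) * D h) mulrDl -scalerAl.
by [].
Qed.

Lemma Ra_basis_t k : Ra_basis (t ^+ k).
Proof. by left; exists k; rewrite Ra_val_X. Qed.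

Lemma Ra_basis_pole i l : Ra_basis (x_ i ^+ l.+1).
Proof. by right; exists i, l.+1; split=> //; rewrite Ra_val_X exprVn. Qed.

(** Bilinearity reduces to pairs of basis elements; there the value comes from the table, from the
    table for the swapped pair by skew-symmetry, or is zero. *)
Lemma phi_spec_unique i B1 B2 (A C : Der a) :
  phi_spec i B1 -> phi_spec i B2 -> B1 A C = B2 A C.
Proof.
move=> [[B1r B1l] B1N B1v B10] [[B2r B2l] B2N B2v B20].
have zr (B : Der a -> Der a -> F) x : (forall x, scalar (B x)) -> B x 0 = 0.
  by move=> Br; have := Br x (-1) 0 0; rewrite scaler0 addr0 mulN1r addNr.
have zl (B : Der a -> Der a -> F) x : (forall x, scalar (B^~ x)) -> B 0 x = 0.
  by move=> Br; have := Br x (-1) 0 0; rewrite scaler0 addr0 mulN1r addNr.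
have vf0 : vf 0 = 0 by exact: lin0 vf_linear.
have ext (P : R -> Prop) : P 0 -> (forall c f g, P f -> P g -> P (c *: f + g)) ->
    (forall f, Ra_basis f -> P f) -> forall f, P f.
  move=> P0 PL Pb; apply: (Ra_basis_ind a_inj) => // [k|j l].
    exact: Pb (Ra_basis_t k).
  exact: Pb (Ra_basis_pole j l).
rewrite [A]Der_vf [C]Der_vf; move: (A t) (C t) => {A C} f g.
move: f; apply: (ext) => [|c f h fE hE|f fb]; first by rewrite vf0 !zl.
  by rewrite vf_linear B1l B2l fE hE.
move: g; apply: (ext) => [|c g h gE hE|g gb]; first by rewrite vf0 !zr.
  by rewrite vf_linear B1r B2r gE hE.
have [[c v]|v1] := pselect (exists c, phi_value i f g c).
  by rewrite (B1v _ _ _ v) (B2v _ _ _ v).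
have [[c v]|v2] := pselect (exists c, phi_value i g f c).
  by rewrite B1N B2N (B1v _ _ _ v) (B2v _ _ _ v).
by rewrite B10 ?B20 // => c v; [apply: v1|apply: v2|apply: v1|apply: v2]; exists c.
Qed.

Lemma phiE i (A B : Der a) : phi a i A B = psi i (A t) (B t).
Proof.
have S := psi_phi_spec i; apply: (phi_spec_unique _ _ _ S).
exact: (xgetI _ S).
Qed.

End PhiIsResidue.

(** * The central extension *)

Section LieAlgebraOfDerivations.
Variables (F : numFieldType) (n : nat) (a : 'I_n -> F).
Hypothesis a_inj : injective a.
Local Notation R := (Ra a).
Local Notation t := (Ra_t a).
Local Notation D := (@Ra_deriv F n a).
Local Notation x_ := (pole a).
Local Notation vf := (@vf F n a).
Implicit Types (f g h : R) (A B C : Der a).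

Lemma vf_t f : vf f t = f.
Proof. by rewrite /= Ra_deriv_t mulr1. Qed.

Lemma Der_t_inj A B : A t = B t -> A = B.
Proof. by move=> e; rewrite [A]Der_vf e -Der_vf. Qed.

Lemma der_bracket_t A B : der_bracket a A B t = wronskian (A t) (B t).
Proof. by rewrite [A]Der_vf [B]Der_vf der_bracket_vf !vf_t. Qed.

Lemma wronskian_linearr f : linear (wronskian f).
Proof.
move=> c g h; rewrite /wronskian linearP mulrDr mulrDl -scalerAr -scalerAl.
by rewrite scalerBr opprD addrACA.
Qed.

Lemma wronskian_linearl g : linear (wronskian ^~ g).
Proof.
by move=> c f h; rewrite wronskianC wronskian_linearr opprD -scalerN -!wronskianC.
Qed.

Let jacobi (A : comNzRingType) (d : A -> A)
    (dD : {morph d : x y / x + y}) (dN : {morph d : x / - x})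
    (dM : forall x y, d (x * y) = d x * y + x * d y) (f g h : A) :
  (f * d (g * d h - h * d g) - (g * d h - h * d g) * d f) +
  (g * d (h * d f - f * d h) - (h * d f - f * d h) * d g) +
  (h * d (f * d g - g * d f) - (f * d g - g * d f) * d h) = 0.
Proof. by rewrite !(dD, dN, dM); ring. Qed.

Lemma wronskianJ f g h : wronskian f (wronskian g h) +
  wronskian g (wronskian h f) + wronskian h (wronskian f g) = 0.
Proof. exact: (jacobi (linearD D) (linearN D) (@Ra_derivM _ _ a)). Qed.

Lemma wronskian_alt f : wronskian f f = 0.
Proof. exact: subrr. Qed.

Lemma lie_bracket_der : lie_bracket (der_bracket a).
Proof.
have Dt c A B : (c *: A + B) t = c *: A t + B t by [].
split=> [A c B C|A c B C|A|A B C]; apply: Der_t_inj.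
- by rewrite Dt !der_bracket_t Dt wronskian_linearr.
- by rewrite Dt !der_bracket_t Dt wronskian_linearl.
- by rewrite der_bracket_t wronskian_alt.
- have AD B' C' : (B' + C') t = B' t + C' t by [].
  by rewrite !AD !der_bracket_t wronskianJ.
Qed.

Definition psi_row f g : 'rV[F]_n := \row_i psi i f g.

Lemma psi_row_linearr f : linear (psi_row f).
Proof. by move=> c g h; apply/rowP => i; rewrite !mxE psi_linearr. Qed.

Lemma psi_rowC f g : psi_row f g = - psi_row g f.
Proof. by apply/rowP => i; rewrite !mxE psiC. Qed.

Lemma psi_row_linearl g : linear (psi_row ^~ g).
Proof.
by move=> c f h; rewrite psi_rowC psi_row_linearr opprD -scalerN -!psi_rowC.
Qed.

Lemma psi_alt i f : psi i f f = 0.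
Proof.
apply/eqP; have /eqP := psiC i f f; rewrite -addr_eq0 -mulr2n.
by rewrite mulrn_eq0.
Qed.

Lemma ext_bracketE x y :
  ext_bracket a x y = (der_bracket a x.1 y.1, psi_row (x.1 t) (y.1 t)).
Proof.
congr pair; rewrite [RHS]row_sum_delta.
by apply: eq_bigr => i _; rewrite mxE phiE.
Qed.

Lemma lie_bracket_ext : lie_bracket (ext_bracket a).
Proof.
have [Lr Ll Lalt LJ] := lie_bracket_der.
have Dt c A B : (c *: A + B) t = c *: A t + B t by [].
split=> [x c y z|x c y z|x|x y z].
- by rewrite !ext_bracketE Lr Dt psi_row_linearr.
- by rewrite !ext_bracketE Ll Dt psi_row_linearl.
- rewrite ext_bracketE Lalt; congr pair.
  by apply/rowP => i; rewrite !mxE psi_alt.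
rewrite !ext_bracketE /fst /snd; congr pair; first exact: LJ.
by apply/rowP => i; rewrite !mxE !der_bracket_t psiJ.
Qed.

Lemma central_extension_ext :
  central_extension (ext_bracket a) (der_bracket a) fst.
Proof.
split.
- exact: lie_bracket_ext.
- exact: lie_bracket_der.
- by split.
- by move=> A; exists (A, 0).
- move=> [A u] /= -> x; rewrite ext_bracketE; have [_ Ll _ _] := lie_bracket_der.
  by rewrite (lin0 (Ll _)) (lin0 (psi_row_linearl _)).
Qed.

Lemma psi_t_low i k f : (k < 3)%N -> psi i (t ^+ k) f = 0.
Proof.
move=> k3; have d3 (p : {poly F}) : p^`()^`()^`() = p^`(3) by [].
rewrite /psi -poly_RaXn !Ra_deriv_poly d3 derivn_poly0.
  by rewrite rmorph0 mul0r linear0.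
by rewrite size_polyXn.
Qed.

Lemma psi_t3_pole i j : psi i (t ^+ 3) (x_ j) = 6%:R * (i == j)%:R.
Proof.
rewrite -[x_ j]expr1; have [<-|ij] := eqVneq i j.
  by rewrite psi_t_pole binn subnn expr0 mulr1 [RHS]mulr1; ring.
by rewrite psi_t_regular ?mulr0 // eq_sym.
Qed.

Lemma psi_sub_t i f c : psi i (t - c%:A) f = 0.
Proof. by rewrite /psi Ra_deriv_sub_t Ra_deriv1 linear0 mul0r linear0. Qed.

Lemma wronskian_sub_t_pole i : wronskian (t - (a i)%:A) (x_ i) = - 2%:R *: x_ i.
Proof. by have := wronskian_sub_t_poleX a i 1; rewrite expr1. Qed.

Lemma ext_bracket_vf f g :
  ext_bracket a (vf f, 0) (vf g, 0) = (vf (wronskian f g), psi_row f g).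
Proof.
rewrite ext_bracketE !vf_t; congr pair; apply: Der_t_inj.
by rewrite der_bracket_t !vf_t.
Qed.

(** Perfectness of the extension, tested by linear maps. The difference of two lifts of the
    projection to a central extension is such a [d], whence uniqueness. *)
Lemma ext_perfect (E : lmodType F) (d : Der a * 'rV[F]_n -> E) : linear d ->
  (forall x y, d (ext_bracket a x y) = 0) -> forall x, d x = 0.
Proof.
move=> dL d0.
have row0 f g : (forall i, psi i f g = 0) -> psi_row f g = 0.
  by move=> H; apply/rowP => i; rewrite !mxE.
(* Derivatives are brackets with d/dt and simple poles are eigenvectors of t - a_i; [psi] vanishes
   on these pairs, so no central term appears. *)
have dvf f : d (vf f, 0) = 0.
  move: f; apply: (Ra_deriv_ind a_inj) => [c f g df dg|g|i].
  - have -> : (vf (c *: f + g), 0) = c *: (vf f, 0) + (vf g, 0) :> Der a * 'rV[F]_n.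
      by apply: injective_projections => /=; [exact: vf_linear | rewrite scaler0 addr0].
    by rewrite dL df dg scaler0 addr0.
  - have := d0 (vf 1, 0) (vf g, 0).
    rewrite ext_bracket_vf wronskian1l row0 // => i.
    by rewrite -[1]/(t ^+ 0) psi_t_low.
  - have := d0 (vf (t - (a i)%:A), 0) (vf (x_ i), 0).
    rewrite ext_bracket_vf wronskian_sub_t_pole row0; last by move=> j; exact: psi_sub_t.
    have -> : (vf (- 2%:R *: x_ i), 0) = - 2%:R *: (vf (x_ i), 0) :> Der a * 'rV[F]_n.
      apply: injective_projections => /=; last by rewrite scaler0.
      exact: (linZ (@vf_linear _ _ a)).
    rewrite (linZ dL) => /eqP; rewrite scaler_eq0 oppr_eq0 pnatr_eq0 /=.
    by move=> /eqP.
(* On t^3 and (t - a_i)^-1 the only nonzero central coordinate is the i-th, equal to 6, so their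
   bracket is 6 c_i plus a vector field already killed by [d]. *)
have dd i : d (0, delta_mx 0 i) = 0.
  have := d0 (vf (t ^+ 3), 0) (vf (x_ i), 0); rewrite ext_bracket_vf.
  have -> : psi_row (t ^+ 3) (x_ i) = 6%:R *: delta_mx 0 i.
    by apply/rowP => j; rewrite !mxE psi_t3_pole.
  have -> : (vf (wronskian (t ^+ 3) (x_ i)), 6%:R *: delta_mx 0 i) =
    6%:R *: (0, delta_mx 0 i) + (vf (wronskian (t ^+ 3) (x_ i)), 0)
    :> Der a * 'rV[F]_n.
    by apply: injective_projections => /=; [rewrite scaler0 add0r | rewrite addr0].
  rewrite dL dvf addr0 => /eqP; rewrite scaler_eq0 pnatr_eq0 /=.
  by move=> /eqP.
move=> [A u]; have -> : (A, u) = (vf (A t), 0) + \sum_i u 0 i *: (0, delta_mx 0 i)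
    :> Der a * 'rV[F]_n.
  rewrite -Der_vf; have -> : \sum_i u 0 i *: (0, delta_mx 0 i) = (0, u) :> Der a * 'rV[F]_n.
    rewrite [in RHS](row_sum_delta u).
    pose inc (v : 'rV[F]_n) : Der a * 'rV[F]_n := (0, v).
    have incL : linear inc.
      move=> c v w; apply: injective_projections => //=.
      by rewrite scaler0 addr0.
    rewrite -[RHS]/(inc _) (lin_sum incL); apply: eq_bigr => i _.
    by rewrite (linZ incL).
  by apply: injective_projections => /=; [rewrite addr0 | rewrite add0r].
rewrite (linD dL) dvf add0r (lin_sum dL) big1 // => i _.
by rewrite (linZ dL) dd scaler0.
Qed.

End LieAlgebraOfDerivations.

(** * Universality *)

Section Universality.
Variables (F : numFieldType) (n : nat) (a : 'I_n -> F).
Hypothesis a_inj : injective a.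
Local Notation R := (Ra a).
Local Notation t := (Ra_t a).
Local Notation D := (@Ra_deriv F n a).
Local Notation x_ := (pole a).
Local Notation vf := (@vf F n a).
Implicit Types (f g h : R) (A C : Der a).

Variables (E : lmodType F) (br : E -> E -> E) (p : E -> Der a).
Hypothesis brp : central_extension br (der_bracket a) p.

Let br_lie : lie_bracket br. Proof. by case: brp. Qed.
Let pL : linear p. Proof. by case: brp => _ _ []. Qed.
Let p_br x y : p (br x y) = der_bracket a (p x) (p y).
Proof. by case: brp => _ _ [_ H] _ _; exact: H. Qed.
Let p_surj A : exists x, p x = A. Proof. by case: brp => _ _ _ H _. Qed.
Let brr x : linear (br x). Proof. by case: br_lie. Qed.
Let brl y : linear (br^~ y). Proof. by case: br_lie. Qed.
Let br_alt x : br x x = 0. Proof. by case: br_lie. Qed.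

Let brC x y : br x y = - br y x.
Proof.
apply/eqP; rewrite -addr_eq0; apply/eqP; have := br_alt (x + y).
rewrite (linD (brr _)) (linD (brl x)) (linD (brl y)) !br_alt add0r addr0.
by rewrite addrC.
Qed.

(** Elements over the same derivation differ by a central one. *)
Let br_proper x x' y y' : p x = p x' -> p y = p y' -> br x y = br x' y'.
Proof.
have bl u u' v : p u = p u' -> br u v = br u' v.
  move=> e; apply/eqP; rewrite -subr_eq0 -(linB (brl v)); apply/eqP.
  by case: brp => _ _ _ _; apply; rewrite (linB pL) e subrr.
by move=> ex ey; rewrite (bl _ _ _ ex) brC (bl _ _ _ ey) -brC.
Qed.

(** The choice is arbitrary and need not be linear; [br_proper] makes brackets of lifts independent
    of it, so [lifted_bracket] is still bilinear. *)
Definition lift f : E := sval (cid (p_surj (vf f))).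

Let p_lift f : p (lift f) = vf f.
Proof. exact: svalP (cid (p_surj (vf f))). Qed.

Definition lifted_bracket f g : E := br (lift f) (lift g).
Local Notation B := lifted_bracket.

Let br_lifted x y : br x y = B (p x t) (p y t).
Proof. by apply: br_proper; rewrite p_lift -Der_vf. Qed.

Let vfL : linear vf := @vf_linear F n a.

Let Bl g : linear (B^~ g).
Proof.
move=> c f h; rewrite /B -(brl (lift g)).
by apply: br_proper => //; rewrite pL !p_lift vfL.
Qed.

Let BC f g : B f g = - B g f. Proof. exact: brC. Qed.

Let Br f : linear (B f).
Proof. by move=> c g h; rewrite BC Bl opprD -scalerN -!BC. Qed.

Let p_B f g : p (B f g) = vf (wronskian f g).
Proof. by rewrite p_br !p_lift der_bracket_vf. Qed.

Let B_wronskian f g h : B f (wronskian g h) = br (lift f) (br (lift g) (lift h)).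
Proof. by apply: br_proper => //; rewrite p_lift p_B. Qed.

Let BJ f g h :
  B f (wronskian g h) + B g (wronskian h f) + B h (wronskian f g) = 0.
Proof. by rewrite !B_wronskian; case: br_lie. Qed.

Let B11 c : B 1 (c%:A) = 0.
Proof. by rewrite (linZ (Br 1)) /B br_alt scaler0. Qed.

Definition antider f : R := sval (cid (antiderivative a_inj f)).

Let antiderP f : f = D (antider f) + \sum_i res i f *: x_ i.
Proof. exact: svalP (cid (antiderivative a_inj f)). Qed.

(* The only lift of f d/dt compatible with [d/dt, g d/dt] = g' d/dt and
   [(t - a_i) d/dt, (t - a_i)^-1 d/dt] = -2 (t - a_i)^-1 d/dt. *)
Definition section f : E := B 1 (antider f) +
  \sum_i (- (2%:R)^-1 * res i f) *: B (t - (a i)%:A) (x_ i).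

(** The arguments differ by a constant, on which [B 1] vanishes. This makes [section] independent of
    the antiderivative chosen. *)
Let B1_deriv_eq f g : D f = D g -> B 1 f = B 1 g.
Proof.
move=> e; apply/eqP; rewrite -subr_eq0 -(linB (Br 1)).
have [|c ->] := @Ra_deriv_eq0 _ _ _ (f - g); last by rewrite B11.
by rewrite linearB /= e subrr.
Qed.

Let section_deriv g : section (D g) = B 1 g.
Proof.
rewrite /section big1 ?addr0 => [|i _]; last by rewrite res_deriv mulr0 scale0r.
apply: B1_deriv_eq; have := antiderP (D g); rewrite big1 ?addr0 // => i _.
by rewrite res_deriv scale0r.
Qed.

Let section_linear : linear section.
Proof.
move=> c f g; rewrite /section scalerDr addrACA; congr (_ + _).
  (* [antider] need not be linear, but its derivative is, and [B 1] depends on nothing else. *)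
  rewrite -(Br 1); apply: B1_deriv_eq; rewrite Ra_deriv_is_linear.
  have H h : D (antider h) = h - \sum_i res i h *: x_ i.
    by rewrite {2}[h]antiderP addrK.
  rewrite !H scalerBr addrACA -opprD; congr (_ - _).
  rewrite scaler_sumr -big_split /=; apply: eq_bigr => i _.
  by rewrite linearP scalerDl scalerA.
rewrite scaler_sumr -big_split /=; apply: eq_bigr => i _.
by rewrite linearP scalerA -scalerDl mulrDr mulrCA.
Qed.

Let section_pole i : section (x_ i) = - (2%:R)^-1 *: B (t - (a i)%:A) (x_ i).
Proof.
rewrite /section (bigD1 i) //= res_pole // eqxx mulr1 big1 ?addr0; last first.
  by move=> j ji; rewrite res_pole // (negbTE ji) mulr0 scale0r.
suff -> : B 1 (antider (x_ i)) = B 1 0 by rewrite (lin0 (Br 1)) add0r.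
apply: B1_deriv_eq; rewrite linear0; apply: (addIr (x_ i)); rewrite add0r.
rewrite [RHS]antiderP; congr (_ + _); rewrite (bigD1 i) //= res_pole // eqxx.
rewrite scale1r big1 ?addr0 // => j ji.
by rewrite res_pole // (negbTE ji) scale0r.
Qed.

Let p_section f : p (section f) = vf f.
Proof.
move: f; apply: (Ra_deriv_ind a_inj) => [c f g fE gE|g|i].
- by rewrite section_linear pL fE gE vfL.
- by rewrite section_deriv p_B wronskian1l.
rewrite section_pole (linZ pL) p_B wronskian_sub_t_pole (linZ vfL) scalerA.
by rewrite mulrNN mulVf ?scale1r // pnatr_eq0.
Qed.

(** The image intended for c_i. The factor 1/6 normalises against [psi i (t ^+ 3) (x_ i)], which is
    6. *)
Definition central_value i : E :=
  (6%:R)^-1 *: (B (t ^+ 3) (x_ i) - section (wronskian (t ^+ 3) (x_ i))).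
Local Notation z_ := central_value.

Let p_central i : p (z_ i) = 0.
Proof. by rewrite (linZ pL) (linB pL) p_B p_section subrr scaler0. Qed.

Let sub2D (V : zmodType) (x1 x2 y1 y2 w1 w2 : V) :
  (x1 + x2) - (y1 + y2) - (w1 + w2) = (x1 - y1 - w1) + (x2 - y2 - w2).
Proof. by rewrite !opprD [_ + _ + (- y1 - y2)]addrACA [LHS]addrACA. Qed.

Let scalerDACA (V : lmodType F) c (x1 x2 y1 y2 : V) :
  (c *: x1 + x2) + (c *: y1 + y2) = c *: (x1 + y1) + (x2 + y2).
Proof. by rewrite scalerDr addrACA. Qed.

(** A cocycle built to satisfy the three normalisations of [cocycle_eq0]: [section] takes care of 1
    and t, the elements [z_ i] of t^3. *)
Let defect f g : E :=
  B f g - section (wronskian f g) - \sum_i psi i f g *: z_ i.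

Let defect_linear f : linear (defect f).
Proof.
move=> c g h; rewrite /defect Br wronskian_linearr section_linear.
rewrite !scalerBr scaler_sumr.
have -> : \sum_i psi i f (c *: g + h) *: z_ i =
  \sum_i c *: (psi i f g *: z_ i) + \sum_i psi i f h *: z_ i.
  rewrite -big_split; apply: eq_bigr => i _.
  by rewrite psi_linearr scalerDl -scalerA.
exact: sub2D.
Qed.

Let defectC f g : defect f g = - defect g f.
Proof.
rewrite /defect BC wronskianC (linN section_linear) !opprB opprK.
have -> : \sum_i psi i f g *: z_ i = - \sum_i psi i g f *: z_ i.
  by rewrite -sumrN; apply: eq_bigr => i _; rewrite psiC scaleNr.
by rewrite opprK addrC [- _ + _]addrC.
Qed.

Let defectJ f g h : defect f (wronskian g h) + defect g (wronskian h f) +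
  defect h (wronskian f g) = 0.
Proof.
rewrite /defect -!sub2D BJ -!(linD section_linear) wronskianJ.
rewrite (lin0 section_linear) subrr add0r -!big_split big1 ?oppr0 // => i _.
by rewrite /= -!scalerDl psiJ scale0r.
Qed.

Let defect1 f : defect 1 f = 0.
Proof.
rewrite /defect wronskian1l section_deriv subrr big1 ?subr0 // => i _.
by rewrite -[1]/(t ^+ 0) psi_t_low ?scale0r.
Qed.

Let defect_t i : defect t (x_ i) = 0.
Proof.
have tE : t = a i *: 1 + (t - (a i)%:A) by rewrite addrC subrK.
have -> : defect t (x_ i) = a i *: defect 1 (x_ i) + defect (t - (a i)%:A) (x_ i).
  by rewrite {1}tE defectC defect_linear opprD -scalerN -!defectC.
rewrite defect1 scaler0 add0r /defect wronskian_sub_t_pole.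
rewrite (linZ section_linear) section_pole scalerA mulrNN divff ?pnatr_eq0 //.
rewrite scale1r subrr big1 ?subr0 // => j _.
by rewrite psi_sub_t scale0r.
Qed.

Let defect_t3 i : defect (t ^+ 3) (x_ i) = 0.
Proof.
rewrite /defect (bigD1 i) //= psi_t3_pole // eqxx mulr1 big1 ?addr0.
  by rewrite /z_ scalerA divff ?pnatr_eq0 // scale1r subrr.
by move=> j ji; rewrite psi_t3_pole // (negbTE ji) mulr0 scale0r.
Qed.

Let B_decomposition f g :
  B f g = section (wronskian f g) + \sum_i psi i f g *: z_ i.
Proof.
have := cocycle_eq0 a_inj defect_linear defectC defectJ defect1 defect_t
  defect_t3 f g.
by move=> /eqP; rewrite /defect -addrA -opprD subr_eq0 => /eqP.
Qed.

Let hom (x : Der a * 'rV[F]_n) : E := section (x.1 t) + \sum_i x.2 0 i *: z_ i.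

Let p_hom x : p (hom x) = x.1.
Proof.
rewrite /hom (linD pL) p_section -Der_vf (lin_sum pL) big1 ?addr0 // => i _.
by rewrite (linZ pL) p_central scaler0.
Qed.

Let hom_linear : linear hom.
Proof.
move=> c x y; rewrite /hom.
have -> : (c *: x + y).1 t = c *: x.1 t + y.1 t by [].
rewrite section_linear -[RHS]scalerDACA; congr (_ + _).
rewrite scaler_sumr -big_split /=; apply: eq_bigr => i _.
by rewrite !mxE scalerDl -scalerA.
Qed.

(** Since [hom x] lies over the derivation [x.1], the right side is [B] at the coefficients, and
    [B_decomposition] matches the central coordinates with the multiples of [z_ i]. *)
Let hom_bracket x y : hom (ext_bracket a x y) = br (hom x) (hom y).
Proof.
rewrite br_lifted !p_hom ext_bracketE // /hom /fst /snd der_bracket_t.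
rewrite B_decomposition; congr (_ + _); apply: eq_bigr => i _.
by rewrite mxE.
Qed.

Lemma unique_hom_to_central_extension :
  exists! k : Der a * 'rV[F]_n -> E,
    lie_hom (ext_bracket a) br k /\ p \o k = fst.
Proof.
exists hom; split.
  split; [split; [exact: hom_linear | exact: hom_bracket]|].
  by apply/funext => x; exact: p_hom.
move=> k [[kL kbr] pk]; apply/funext => x; apply/eqP; rewrite -subr_eq0; apply/eqP.
have pk' y : p (k y) = y.1 by rewrite -pk.
(* Both maps lift the projection, so by [br_proper] they agree on every bracket. *)
apply: (ext_perfect a_inj (d := fun x => hom x - k x)) => [c y w|y w].
  by rewrite hom_linear kL opprD addrACA scalerBr.
rewrite hom_bracket kbr; apply/eqP; rewrite subr_eq0; apply/eqP.
by apply: br_proper; rewrite p_hom pk'.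
Qed.

End Universality.

Theorem mainTheorem8 (R : realType) (n : nat) (n_gt0 : (0 < n)%N)
    (a : 'I_n -> R[i]%C) (a_inj : injective a) :
  universal_central_extension (ext_bracket a) (der_bracket a)
    (fst : Der a * 'rV[R[i]%C]_n -> Der a).
Proof.
split; first exact: (central_extension_ext a_inj).
move=> E br p brp; exact: (unique_hom_to_central_extension a_inj brp).
Qed.
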